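(* Assume that $(\mathcal{H}_T)$, $(\mathcal{H}_K)$, $(\mathcal{H}_\varphi)$, $(\mathcal{H}_0)$, $(\mathcal{H}_1)$, $(\mathcal{H}_2)$, $(\mathcal{H}_3)$ hold and $m\in V^*$. Let $Z$ be a real Hilbert space into which $V$ is continuously embedded, and let $z\in Z$. For $\kappa>0$ and $a\in A$ define $$J_\kappa(a):=\min_{u\in\Gamma(a)}\tfrac12\|u-z\|_Z^2+\kappa R(a).$$ Then for every $a\in A$ the minimum over $\Gamma(a)$ is attained (so $J_\kappa$ is well defined on $A$), and for each $\kappa>0$ there exists $a^*\in A$ with $J_\kappa(a^* )=\inf_{b\in A}J_\kappa(b)$.
   Context: Let $V$ be a real reflexive Banach space with dual $V^*$ and duality pairing $\langle\cdot,\cdot\rangle$, let $C\subseteq V$ be nonempty, closed and convex, let $B$ be a real Banach space and $A\subseteq B$ a nonempty set of parameters. Given $T\colon B\times V\to V^*$, $\varphi\colon V\to\mathbb{R}\cup\{+\infty\}$, $K\colon C\to 2^C$ and $m\in V^*$, for $a\in A$ the mixed quasi-variational inequality $\mathrm{MQVI}(a)$ is: find $u\in C$ with $u\in K(u)$ and $\langle T(a,u),v-u\rangle+\varphi(v)-\varphi(u)\ge\langle m,v-u\rangle$ for all $v\in K(u)$. $\Gamma(a)$ denotes the set of solutions of $\mathrm{MQVI}(a)$. Hypothesis $(\mathcal{H}_T)$: $T$ is bounded (maps bounded sets to bounded sets); for each $u\in V$ the map $T(\cdot,u)\colon B\to V^*$ is linear; for each $a\in A$ the map $T(a,\cdot)\colon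 V\to V^*$ is monotone and continuous. Hypothesis $(\mathcal{H}_\varphi)$: $\varphi$ is proper, convex and lower semicontinuous, and $C\subseteq\operatorname{int}(\operatorname{dom}\varphi)$. Hypothesis $(\mathcal{H}_K)$: for every $u\in C$ the set $K(u)\subseteq C$ is nonempty, closed and convex, and (i) for any sequence $\{x_n\}\subset C$ with $x_n\rightharpoonup x$ weakly and any $y\in K(x)$ there is a sequence $\{y_n\}\subset C$ with $y_n\in K(x_n)$ and $y_n\to y$ strongly; (ii) for any sequences $\{x_n\},\{y_n\}\subset C$ with $y_n\in K(x_n)$, $x_n\rightharpoonup x$ and $y_n\rightharpoonup y$, one has $y\in K(x)$. Hypothesis $(\mathcal{H}_0)$: there is a bounded set $C_0\subseteq V$ with $K(u)\cap C_0\neq\emptyset$ for every $u\in C$, and a function $h\colon[0,\infty)\to\mathbb{R}$ with $h(t)\to+\infty$ as $t\to+\infty$ such that $\langle T(a,w),w-v_0\rangle+\varphi(w)-\varphi(v_0)\ge h(\|w\|_V)\|w\|_V$ for all $v_0\in C_0$, $a\in A$, $w\in C$. Hypothesis $(\mathcal{H}_1)$: $L$ and $E$ are Banach spaces, $B$ is continuously embedded in $L$, $E$ is compactly embedded in $L$, and $A\subseteq B\cap E$ is closed and bounded in $B$ and closed in $L$. Hypothesis $(\mathcal{H}_2)$: whenever $\{a_n\}\subset A$ is bounded in $B$ and $a_n\to a\in A$ strongly in $L$, $v_n\to v$ strongly in $V$, and $\{u_n\}\subset V$ is bounded, then $\limsup_{n\to\infty}\langle T(a_n-a,v_n),u_n\rangle\le0$.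 Hypothesis $(\mathcal{H}_3)$: $R\colon E\to\mathbb{R}$ is convex, lower semicontinuous with respect to the norm of $L$, and there are $\tau_1,\tau_2>0$ with $R(a)\ge\tau_1\|a\|_E-\tau_2$ for all $a\in A$. *)

(* Defs.v *)
From Stdlib Require Import Reals Lra.
Open Scope R_scope.

Record NormedSpace := {
  ns_car :> Type;
  ns_zero : ns_car;
  ns_add : ns_car -> ns_car -> ns_car;
  ns_opp : ns_car -> ns_car;
  ns_scal : R -> ns_car -> ns_car;
  ns_norm : ns_car -> R;
  ns_add_assoc : forall x y z, ns_add x (ns_add y z) = ns_add (ns_add x y) z;
  ns_add_comm : forall x y, ns_add x y = ns_add y x;
  ns_add_zero : forall x, ns_add x ns_zero = x;
  ns_add_opp : forall x, ns_add x (ns_opp x) = ns_zero;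
  ns_scal_one : forall x, ns_scal 1 x = x;
  ns_scal_assoc : forall r s x, ns_scal r (ns_scal s x) = ns_scal (r * s) x;
  ns_scal_distr_l : forall r x y, ns_scal r (ns_add x y) = ns_add (ns_scal r x) (ns_scal r y);
  ns_scal_distr_r : forall r s x, ns_scal (r + s) x = ns_add (ns_scal r x) (ns_scal s x);
  ns_norm_eq0 : forall x, ns_norm x = 0 -> x = ns_zero;
  ns_norm_triangle : forall x y, ns_norm (ns_add x y) <= ns_norm x + ns_norm y;
  ns_norm_scal : forall r x, ns_norm (ns_scal r x) = Rabs r * ns_norm x
}.

Arguments ns_zero {_}.
Arguments ns_add {_} _ _.
Arguments ns_opp {_} _.
Arguments ns_scal {_} _ _.
Arguments ns_norm {_} _.

Definition ns_sub {X : NormedSpace} (x y : X) : X := ns_add x (ns_opp y).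

Definition ns_cv {X : NormedSpace} (u : nat -> X) (l : X) : Prop :=
  forall eps, eps > 0 -> exists N, forall n, (n >= N)%nat -> ns_norm (ns_sub (u n) l) < eps.

Definition ns_Cauchy {X : NormedSpace} (u : nat -> X) : Prop :=
  forall eps, eps > 0 -> exists N, forall n p, (n >= N)%nat -> (p >= N)%nat ->
    ns_norm (ns_sub (u n) (u p)) < eps.

Definition completeS (X : NormedSpace) : Prop :=
  forall u : nat -> X, ns_Cauchy u -> exists l, ns_cv u l.

Record Banach := { bs_ns :> NormedSpace; bs_complete : completeS bs_ns }.

Definition boundedS {X : NormedSpace} (S : X -> Prop) : Prop :=
  exists M, forall x, S x -> ns_norm x <= M.

Definition bounded_seq {X : NormedSpace} (u : nat -> X) : Prop :=
  exists M, forall n, ns_norm (u n) <= M.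

Definition closedS {X : NormedSpace} (S : X -> Prop) : Prop :=
  forall (u : nat -> X) l, (forall n, S (u n)) -> ns_cv u l -> S l.

Definition convexS {X : NormedSpace} (S : X -> Prop) : Prop :=
  forall x y t, S x -> S y -> 0 <= t <= 1 ->
    S (ns_add (ns_scal t x) (ns_scal (1 - t) y)).

Definition ne_set {X : Type} (S : X -> Prop) : Prop := exists x, S x.

Definition is_linear {X Y : NormedSpace} (f : X -> Y) : Prop :=
  (forall x y, f (ns_add x y) = ns_add (f x) (f y)) /\
  (forall r x, f (ns_scal r x) = ns_scal r (f x)).

Definition bounded_linear {X Y : NormedSpace} (f : X -> Y) : Prop :=
  is_linear f /\ exists M, forall x, ns_norm (f x) <= M * ns_norm x.

Definition cont_embedding {X Y : NormedSpace} (i : X -> Y) : Prop :=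
  bounded_linear i /\ (forall x y, i x = i y -> x = y).

Definition compact_embedding {X Y : NormedSpace} (i : X -> Y) : Prop :=
  cont_embedding i /\
  forall u : nat -> X, bounded_seq u ->
    exists (phi : nat -> nat) (l : Y),
      (forall n, (phi n < phi (S n))%nat) /\ ns_cv (fun n => i (u (phi n))) l.

Definition functional_bounded_by {X : NormedSpace} (f : X -> R) (c : R) : Prop :=
  forall x, Rabs (f x) <= c * ns_norm x.

Definition in_dual {X : NormedSpace} (f : X -> R) : Prop :=
  (forall x y, f (ns_add x y) = f x + f y) /\
  (forall r x, f (ns_scal r x) = r * f x) /\
  exists c, functional_bounded_by f c.

Definition dual_cv {X : NormedSpace} (f : nat -> X -> R) (g : X -> R) : Prop :=
  forall eps, eps > 0 -> exists N, forall n, (n >= N)%nat ->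
    functional_bounded_by (fun x => f n x - g x) eps.

Definition reflexive (X : NormedSpace) : Prop :=
  forall Phi : (X -> R) -> R,
    (forall f g, in_dual f -> in_dual g -> Phi (fun x => f x + g x) = Phi f + Phi g) ->
    (forall r f, in_dual f -> Phi (fun x => r * f x) = r * Phi f) ->
    (exists M, forall f c, in_dual f -> 0 <= c -> functional_bounded_by f c ->
                 Rabs (Phi f) <= M * c) ->
    exists x : X, forall f, in_dual f -> Phi f = f x.

Definition weak_cv {X : NormedSpace} (u : nat -> X) (l : X) : Prop :=
  forall f, in_dual f -> Un_cv (fun n => f (u n)) (f l).

Record Hilbert := {
  hs_bs :> Banach;
  hs_inner : hs_bs -> hs_bs -> R;
  hs_inner_sym : forall x y, hs_inner x y = hs_inner y x;
  hs_inner_add : forall x y z, hs_inner (ns_add x y) z = hs_inner x z + hs_inner y z;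
  hs_inner_scal : forall r x y, hs_inner (ns_scal r x) y = r * hs_inner x y;
  hs_norm_inner : forall x, ns_norm x = sqrt (hs_inner x x)
}.

(* ---------- extended-real valued functions: None = +infinity ---------- *)
Definition ERbar := option R.

Definition ext_gt (o : ERbar) (r : R) : Prop :=
  match o with None => True | Some p => r < p end.

Definition proper_fun {X : NormedSpace} (phi : X -> ERbar) : Prop :=
  exists x, phi x <> None.

Definition convex_fun {X : NormedSpace} (phi : X -> ERbar) : Prop :=
  forall x y px py t, phi x = Some px -> phi y = Some py -> 0 <= t <= 1 ->
    exists p, phi (ns_add (ns_scal t x) (ns_scal (1 - t) y)) = Some p /\
              p <= t * px + (1 - t) * py.

Definition lsc_fun {X : NormedSpace} (phi : X -> ERbar) : Prop :=
  forall x r, ext_gt (phi x) r ->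
    exists delta, delta > 0 /\
      forall y, ns_norm (ns_sub y x) < delta -> ext_gt (phi y) r.

Definition subset_int_dom {X : NormedSpace} (S : X -> Prop) (phi : X -> ERbar) : Prop :=
  forall x, S x -> exists delta, delta > 0 /\
    forall y, ns_norm (ns_sub y x) < delta -> phi y <> None.

Definition Gamma {B V : NormedSpace} (T : B -> V -> V -> R) (phi : V -> ERbar)
  (C : V -> Prop) (K : V -> V -> Prop) (m : V -> R) (a : B) (u : V) : Prop :=
  C u /\ K u u /\
  exists pu, phi u = Some pu /\
    forall v, K u v ->
      match phi v with
      | None => True
      | Some pv => T a u (ns_sub v u) + pv - pu >= m (ns_sub v u)
      end.

Definition H_T {B V : NormedSpace} (A : B -> Prop) (T : B -> V -> V -> R) : Prop :=
  (forall a u, in_dual (T a u)) /\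
  (forall Mb Mv, exists M, forall a u, ns_norm a <= Mb -> ns_norm u <= Mv ->
      functional_bounded_by (T a u) M) /\
  (forall a1 a2 u w, T (ns_add a1 a2) u w = T a1 u w + T a2 u w) /\
  (forall r a u w, T (ns_scal r a) u w = r * T a u w) /\
  (forall a, A a -> forall u v, T a u (ns_sub u v) - T a v (ns_sub u v) >= 0) /\
  (forall a, A a -> forall u eps, eps > 0 -> exists delta, delta > 0 /\
      forall v, ns_norm (ns_sub v u) < delta ->
        functional_bounded_by (fun w => T a v w - T a u w) eps).

Definition H_phi {V : NormedSpace} (C : V -> Prop) (phi : V -> ERbar) : Prop :=
  proper_fun phi /\ convex_fun phi /\ lsc_fun phi /\ subset_int_dom C phi.

Definition H_K {V : NormedSpace} (C : V -> Prop) (K : V -> V -> Prop) : Prop :=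
  (forall u, C u ->
     (forall v, K u v -> C v) /\ ne_set (K u) /\ closedS (K u) /\ convexS (K u)) /\
  (forall (x : nat -> V) xl yl, (forall n, C (x n)) -> weak_cv x xl -> K xl yl ->
     exists y : nat -> V, (forall n, C (y n)) /\ (forall n, K (x n) (y n)) /\ ns_cv y yl) /\
  (forall (x y : nat -> V) xl yl, (forall n, C (x n)) -> (forall n, C (y n)) ->
     (forall n, K (x n) (y n)) -> weak_cv x xl -> weak_cv y yl -> K xl yl).

Definition H_0 {B V : NormedSpace} (A : B -> Prop) (T : B -> V -> V -> R)
  (phi : V -> ERbar) (C : V -> Prop) (K : V -> V -> Prop) : Prop :=
  exists (C0 : V -> Prop) (h : R -> R),
    boundedS C0 /\
    (forall u, C u -> exists v, K u v /\ C0 v) /\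
    (forall M, exists t0, forall t, t >= t0 -> h t >= M) /\
    (forall v0 a w, C0 v0 -> A a -> C w ->
       exists pw pv0, phi w = Some pw /\ phi v0 = Some pv0 /\
         T a w (ns_sub w v0) + pw - pv0 >= h (ns_norm w) * ns_norm w).

(* H_1: iBL : B -> L continuous embedding, iEL : E -> L compact embedding,
   A subset of B /\ E (jAE a is the E-element of a in A, i.e. iEL (jAE a) = iBL a),
   A closed and bounded in B, closed in L *)
Definition H_1 {B L E : NormedSpace} (iBL : B -> L) (iEL : E -> L) (jAE : B -> E)
  (A : B -> Prop) : Prop :=
  cont_embedding iBL /\ compact_embedding iEL /\
  (forall a, A a -> iEL (jAE a) = iBL a) /\
  closedS A /\ boundedS A /\
  (forall (a : nat -> B) l, (forall n, A (a n)) -> ns_cv (fun n => iBL (a n)) l ->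
     exists b, A b /\ iBL b = l).

Definition H_2 {B L V : NormedSpace} (iBL : B -> L) (A : B -> Prop)
  (T : B -> V -> V -> R) : Prop :=
  forall (a : nat -> B) al (v : nat -> V) vl (u : nat -> V),
    (forall n, A (a n)) -> bounded_seq a -> A al ->
    ns_cv (fun n => iBL (a n)) (iBL al) -> ns_cv v vl -> bounded_seq u ->
    forall eps, eps > 0 -> exists N, forall n, (n >= N)%nat ->
      T (ns_sub (a n) al) (v n) (u n) <= eps.

Definition H_3 {B L E : NormedSpace} (iEL : E -> L) (jAE : B -> E) (A : B -> Prop)
  (Rf : E -> R) : Prop :=
  (forall x y t, 0 <= t <= 1 ->
     Rf (ns_add (ns_scal t x) (ns_scal (1 - t) y)) <= t * Rf x + (1 - t) * Rf y) /\
  (forall e r, r < Rf e -> exists delta, delta > 0 /\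
     forall e', ns_norm (ns_sub (iEL e') (iEL e)) < delta -> r < Rf e') /\
  (exists tau1 tau2, tau1 > 0 /\ tau2 > 0 /\
     forall a, A a -> Rf (jAE a) >= tau1 * ns_norm (jAE a) - tau2).

Definition cost {B V E : NormedSpace} {Z : Hilbert} (iVZ : V -> Z) (z : Z)
  (jAE : B -> E) (Rf : E -> R) (kappa : R) (a : B) (u : V) : R :=
  / 2 * (ns_norm (ns_sub (iVZ u) z)) ^ 2 + kappa * Rf (jAE a).

Definition is_J {B V E : NormedSpace} {Z : Hilbert} (T : B -> V -> V -> R)
  (phi : V -> ERbar) (C : V -> Prop) (K : V -> V -> Prop) (m : V -> R)
  (iVZ : V -> Z) (z : Z) (jAE : B -> E) (Rf : E -> R) (kappa : R) (a : B) (val : R) : Prop :=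
  (exists u, Gamma T phi C K m a u /\ cost iVZ z jAE Rf kappa a u = val) /\
  (forall u, Gamma T phi C K m a u -> val <= cost iVZ z jAE Rf kappa a u).

(* Main.v *)
From Stdlib Require Import Reals Lra.
From HB Require Import structures.
From mathcomp Require Import all_boot zify.
Require Import Defs.
Set Implicit Arguments.
Unset Strict Implicit.
Open Scope R_scope.

(** Freezing the constraint set to [K w] gives a monotone variational inequality;
  its solutions form a convex set, and coercivity bounds them uniformly in the
  parameter and in [w].  The map from [w] to these solutions has a weakly
  sequentially closed graph: pass to the limit in Minty's form of the inequality,
  where [H_2] absorbs the variation of the parameter and continuity of [phi] on
  the interior of its domain (Baire) handles the strongly convergent test points.
  Kluge's fixed point theorem then makes [Gamma a] nonempty, and the same closedness
  along [a n -> a] in [L], together with weak sequential compactness of bounded sets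
  and weak lower semicontinuity of the cost, gives both minima.  Since [T = 0] with
  [K] single valued is allowed, Brouwer's theorem is unavoidable; it enters through
  Scarf's combinatorial theorem. *)

(** * Scarf's theorem *)

(** The hypotheses on [K] speak only of sequences, while the weak topology is in general not
    metrizable on bounded sets. Compactness is therefore obtained along ultrafilters, straight from
    reflexivity, and then brought down to sequences inside the closed convex hull of countably many
    points, where a sequence of functionals separates points.

    Minty's form is forced by the mode of convergence: the solutions [u n] converge only weakly, so
    [T (a n) (u n)] has no accessible limit, whereas [T (a n) (y n)] with [y n] strongly convergent
    falls under [H_2] and continuity.

    Scarf's theorem works with finitely many linear orders in place of a triangulation, which keeps
    the combinatorics to finite sets and one parity count. The resulting fixed point theorem on the
    simplex serves twice: for finitely many Minty inequalities at once, and for the approximate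
    fixed points behind Kluge's theorem. *)

Section Scarf.
Local Open Scope nat_scope.
Variables (X I : finType) (r : I -> X -> nat).
Hypothesis r_inj : forall i, injective (r i).

(** Tested at [y] in [s], this makes each point of [s] the least one of [s] for some index of [C],
    so [#|s| <= #|C|]. Tested elsewhere, it says that no point lies above all these minima. *)
Definition dominant (s : {set X}) (C : {set I}) :=
  [forall y, [exists i in C, [forall x in s, r i y <= r i x]]].

Lemma dominantP (s : {set X}) (C : {set I}) :
  reflect (forall y, exists2 i, i \in C & forall x, x \in s -> r i y <= r i x)
          (dominant s C).
Proof.
apply: (iffP forallP) => H y.
  by have /exists_inP[i iC /forall_inP h] := H y; exists i.
by have [i iC h] := H y; apply/exists_inP; exists i => //; apply/forall_inP.
Qed.

Lemma dominantS (s s' : {set X}) (C C' : {set I}) :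
  s' \subset s -> C \subset C' -> dominant s C -> dominant s' C'.
Proof.
move=> /subsetP ss /subsetP CC /dominantP H; apply/dominantP => y.
have [i iC h] := H y; exists i; first exact: CC.
by move=> x xs; apply/h/ss.
Qed.

(** Rooms are the balanced dominant pairs. Passing to an incident pair with one index in excess
    means dropping a point or adding an index, and both keep dominance. *)
Definition room (p : {set X} * {set I}) := dominant p.1 p.2 && (#|p.1| == #|p.2|).
Definition incident (p d : {set X} * {set I}) := (d.1 \subset p.1) && (p.2 \subset d.2).

(** The cardinalities give [(#|p.1| - #|d.1|) + (#|d.2| - #|p.2|) = 1] with both terms nonnegative,
    so exactly one of the two inclusions is strict, by one element. *)
Lemma incidentP (p d : {set X} * {set I}) :
  #|p.1| = #|p.2| -> #|d.2| = #|d.1|.+1 -> incident p d ->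
  (p.2 = d.2 /\ exists2 x, x \notin d.1 & p.1 = x |: d.1) \/
  (p.1 = d.1 /\ exists2 i, i \in d.2 & p.2 = d.2 :\ i).
Proof.
case: p => t D; case: d => s C /= tD Cs /andP[/= st DC].
have := subset_leq_card st; have := subset_leq_card DC => h1 h2.
have [ts|ts] := eqVneq #|t| #|s|.
  right; have e : t = s by apply/eqP; rewrite eq_sym eqEcard st ts leqnn.
  split => //; have : #|C :\: D| = 1 by rewrite cardsD (setIidPr DC); lia.
  move=> /eqP/cards1P[i Ei]; have : i \in C :\: D by rewrite Ei inE.
  rewrite inE => /andP[iD iC]; exists i => //.
  by rewrite -Ei setDDr setDv set0U; symmetry; apply/setIidPr.
left; have e : D = C by apply/eqP; rewrite eqEcard DC /=; lia.
split => //; have : #|t :\: s| = 1 by rewrite cardsD (setIidPr st); lia.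
move=> /eqP/cards1P[x Ex]; have : x \in t :\: s by rewrite Ex inE.
rewrite inE => /andP[xs xt]; exists x => //.
by rewrite -Ex setUC -{1}(setIidPr st) setID.
Qed.

(* A dominant pair [(s, C)] with one index more than points has exactly one
   coincidence [mu a = mu b] among the points [mu i] of [s] minimal for [r i];
   the two incident rooms arise by giving [a], respectively [b], a new minimal
   point or by deleting it from [C] when no such point exists. *)
Lemma card_incident_rooms (s : {set X}) (C : {set I}) :
  s != set0 -> dominant s C -> #|C| = #|s|.+1 ->
  #|[set p | room p && incident p (s, C)]| = 2.
Proof.
move=> /set0Pn[x0 x0s] domC cardC.
pose mu i := [arg min_(x < x0 in s) r i x].
have mu_s i : mu i \in s by rewrite /mu; case: arg_minnP.
have mu_le i x : x \in s -> r i (mu i) <= r i x.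
  by rewrite /mu; case: arg_minnP => // y _ h; apply: h.
have mu_eq i x : x \in s -> (forall y, y \in s -> r i x <= r i y) -> x = mu i.
  move=> xs h; apply: (@r_inj i); apply/eqP.
  by rewrite eqn_leq h ?mu_s // mu_le.
have mu_onto (D : {set I}) : dominant s D -> mu @: D = s.
  move=> /dominantP H; apply/setP => x; apply/imsetP/idP => [[i _ ->]//|xs].
  by have [i iD h] := H x; exists i => //; apply: mu_eq.
(* [mu] maps [C] onto [s] and [C] has one element more, so [mu] cannot be injective on [C]. *)
have [a aC [b /setD1P[ba bC] mab]] : exists2 a, a \in C &
    exists2 b, b \in C :\ a & mu a = mu b.
  have /injectivePn/= ninj : ~~ injectiveb (fun i : {i | i \in C} => mu (val i)).
    apply/negP => /injectiveP inj.
    have injC : {in C &, injective mu}.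
      move=> i j iC jC e; have := inj (exist _ i iC) (exist _ j jC) e.
      by move=> /(congr1 val).
    by have := card_in_imset injC; rewrite mu_onto // cardC; lia.
  case: ninj => -[i iC] [[j jC]] nij /= e; exists i => //; exists j => //.
  by rewrite !inE jC andbT; apply: contra_neq nij => ji; apply: val_inj.
(* [M i] holds the candidates that could become the new least point for [i] while every other index
   of [C] keeps its minimum. *)
pose M i := [set y | [forall l in C :\ i, r l (mu l) < r l y]].
have inM i y : reflect (forall l, l \in C -> l != i -> r l (mu l) < r l y) (y \in M i).
  rewrite inE; apply: (iffP forall_inP) => h l; first by move=> lC li; apply: h; rewrite !inE li.
  by rewrite !inE => /andP[li lC]; apply: h.
have M_lt i y : y \in M i -> i \in C -> r i y <= r i (mu i).
  move=> /inM h iC; have /dominantP/(_ y)[j jC hj] := domC.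
  have [e|ji] := eqVneq j i; first by rewrite -{1 2}e; move: (hj _ (mu_s i)); rewrite e.
  by have := h j jC ji; rewrite ltnNge hj.
have MC i j y : i \in C -> i != j -> y \in M i -> y \in M j -> False.
  move=> iC ij yi /inM/(_ i iC ij); rewrite ltnNge => /negP; apply.
  exact: M_lt.
have Ms i y : i \in [set a; b] -> y \in M i -> y \notin s.
  move=> iab /inM h; apply/negP => ys.
  have : y \in mu @: C by rewrite mu_onto.
  move=> /imsetP[l lC yl]; have [li|li] := eqVneq l i; last first.
    by have := h l lC li; rewrite -yl ltnn.
  move: iab; rewrite -li !inE => /orP[/eqP la|/eqP lb].
    have := h b bC; rewrite -li la ba => /(_ isT).
    by rewrite yl la mab ltnn.
  have := h a aC; rewrite -li lb eq_sym ba => /(_ isT).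
  by rewrite yl lb -mab ltnn.
(* If [mu] stays onto after [l] is removed, it is injective there by cardinality, so [l] must break
   the coincidence of [a] and [b]. *)
have cases l : l \in C -> mu @: (C :\ l) = s -> l \in [set a; b].
  move=> lC hd; rewrite !inE; apply/negPn/negP; rewrite negb_or => /andP[la lb].
  have /imset_injP inj : #|mu @: (C :\ l)| == #|C :\ l|.
    by rewrite hd; have := cardsD1 l C; rewrite lC cardC; lia.
  have := inj a b; rewrite !inE aC bC eq_sym la eq_sym lb.
  by move=> /(_ isT isT mab) e; rewrite e eqxx in ba.
have domD i : i \in [set a; b] -> M i = set0 -> dominant s (C :\ i).
  move=> iab M0; apply/dominantP => y; have : y \notin M i by rewrite M0 inE.
  rewrite inE => /forall_inPn[l lC]; rewrite -leqNgt => h.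
  by exists l => // x xs; apply: leq_trans h _; apply: mu_le.
(* The [r i]-largest candidate is taken, so that no other candidate exceeds the new minimum and
   dominance survives. The default [x0] only serves an empty [M i]. *)
pose nx i := odflt x0 [pick x in M i | [forall y in M i, r i y <= r i x]].
have nxP i : M i != set0 -> nx i \in M i /\ forall y, y \in M i -> r i y <= r i (nx i).
  move=> /set0Pn[y0 y0M]; rewrite /nx.
  case: pickP => [x /andP[xM /forall_inP h]|h]; first by split.
  exfalso; case: (arg_maxnP (r i) y0M) => x xM hx.
  by have /negP := h x; apply; apply/andP; split => //; apply/forall_inP.
pose nb i := if M i == set0 then (s, C :\ i) else (nx i |: s, C).
have iC i : i \in [set a; b] -> i \in C by rewrite !inE => /orP[]/eqP->.
have nb_room i : i \in [set a; b] -> room (nb i) && incident (nb i) (s, C).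
  move=> iab; rewrite /nb; case: eqP => [M0|/eqP M0].
    rewrite /room /incident /= domD //= subxx subsetDl andbT.
    by have := cardsD1 i C; rewrite iC // cardC; lia.
  have [nM nmax] := nxP i M0.
  rewrite /room /incident /= subxx subsetUr cardsU1 (Ms i) // cardC add1n eqxx !andbT.
  apply/dominantP => y; have [yM|] := boolP (y \in M i).
    exists i; first exact: iC.
    move=> x /setU1P[->|xs]; first exact: nmax.
    by apply: leq_trans (mu_le _ _ xs); apply: M_lt => //; apply: iC.
  rewrite inE => /forall_inPn[l]; rewrite !inE => /andP[li lC]; rewrite -leqNgt => h.
  exists l => // x /setU1P[->|xs]; last by apply: leq_trans h _; apply: mu_le.
  by apply: (leq_trans h); apply: ltnW; move/inM: nM; apply.
suff -> : [set p | room p && incident p (s, C)] = [set nb a; nb b].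
  rewrite cards2; suff -> : nb a != nb b by [].
  rewrite /nb; have [Ma|Ma] := eqVneq (M a) set0; have [Mb|Mb] := eqVneq (M b) set0.
  - apply/eqP => -[] /setP/(_ a); by rewrite !inE eqxx aC [a == b]eq_sym ba.
  - apply/eqP => -[] _ /setP/(_ a); by rewrite !inE eqxx aC.
  - apply/eqP => -[] _ /setP/(_ b); by rewrite !inE eqxx bC.
  - have [na _] := nxP a Ma; have [nb' _] := nxP b Mb.
    apply/eqP => -[] /setP/(_ (nx a)); rewrite !inE eqxx /= => /esym/orP[/eqP e|].
      by apply: (MC a b (nx a)) => //; rewrite ?e // eq_sym.
    by apply/negP/(Ms a) => //; rewrite !inE eqxx.
apply/setP => p; rewrite !inE; apply/idP/idP; last first.
  by case/orP => /eqP->; apply: nb_room; rewrite !inE eqxx ?orbT.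
case: p => t D /andP[/andP[/= dtD /eqP tD] inc].
have [/= [e [x xs ts]]|/= [e [i iC' DC]]] := @incidentP (t, D) (s, C) tD cardC inc; last first.
  rewrite e DC in dtD tD *; have iab := cases i iC' (mu_onto (C :\ i) dtD).
  have M0 : M i = set0.
    apply/eqP/set0Pn => -[y yM]; have /dominantP/(_ y)[l lC hl] := dtD.
    move: lC; rewrite !inE => /andP[li lC].
    by move/inM: yM => /(_ l lC li); rewrite ltnNge hl.
  by move: iab; rewrite !inE => /orP[]/eqP E; rewrite /nb -E M0 eqxx eqxx ?orbT.
rewrite {}e {}ts {D inc} in dtD tD *.
(* [mu' i] is the least point of [x |: s] for [i]. It maps [C] bijectively onto [x |: s], so the new
   point [x] is least for exactly one index, which is then shown to be [a] or [b]. *)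
pose mu' i := if r i x < r i (mu i) then x else mu i.
have mu'_le i y : y \in x |: s -> r i (mu' i) <= r i y.
  rewrite /mu'; case: ltnP => h /setU1P[->|ys] //; last exact: mu_le.
  by apply: ltnW; apply: leq_trans h _; apply: mu_le.
have mu'_onto : mu' @: C = x |: s.
  apply/setP => y; apply/imsetP/idP => [[i _ ->]|ys].
    by rewrite /mu' !inE; case: ltnP => _; rewrite ?eqxx // mu_s orbT.
  have /dominantP/(_ y)[i iC' h] := dtD; exists i => //; apply: (@r_inj i).
  apply/eqP; rewrite eqn_leq mu'_le // andbT; apply: h.
  by rewrite /mu' !inE; case: ltnP => _; rewrite ?eqxx // mu_s orbT.
have mu'_inj : {in C &, injective mu'} by apply/imset_injP; rewrite mu'_onto tD.
have /imsetP[i iC' xi] : x \in mu' @: C by rewrite mu'_onto !inE eqxx.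
have mu'E l : l \in C -> l != i -> mu' l = mu l.
  rewrite {1}/mu'; case: ltnP => // h lC li; case/eqP: li; apply: mu'_inj => //.
  by rewrite -xi /mu' h.
have xM : x \in M i.
  apply/inM => l lC li; rewrite ltn_neqAle -(mu'E l) // mu'_le ?inE ?eqxx // andbT.
  rewrite (inj_eq (@r_inj l)) mu'E //; apply: contraNneq xs => <-; exact: mu_s.
have iab : i \in [set a; b].
  apply: cases => //; apply/setP => y; apply/imsetP/idP => [[l _ ->]//|ys].
  have /imsetP[l lC yl] : y \in mu' @: C by rewrite mu'_onto !inE ys orbT.
  have li : l != i by apply: contraNneq xs => e; rewrite xi -e -yl.
  by exists l; rewrite ?inE ?li // yl mu'E.
have M0 : M i != set0 by apply/set0Pn; exists x.
have [nM nmax] := nxP i M0.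
have xn : x = nx i.
  apply: (@r_inj i); apply/eqP; rewrite eqn_leq nmax //=.
  have /dominantP/(_ (nx i))[j jC hj] := dtD.
  have [ji|ji] := eqVneq j i; first by rewrite ji in hj; apply: hj; rewrite !inE eqxx.
  have := hj (mu j); rewrite !inE mu_s orbT => /(_ isT).
  by move/inM: nM => /(_ j jC ji); rewrite ltnNge => /negPf->.
by move: iab; rewrite !inE => /orP[]/eqP E; rewrite /nb -E (negPf M0) -xn eqxx ?orbT.
Qed.


Variables (c : X -> I) (k : I).

(** An almost fully labelled pair in the manner of Sperner: the cardinalities make [c] injective on
    the points, and [k] is the only missing label. *)
Definition door (d : {set X} * {set I}) :=
  [&& dominant d.1 d.2, #|d.2| == #|d.1|.+1, k \in d.2 & c @: d.1 == d.2 :\ k].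

Lemma doorP (p d : {set X} * {set I}) : room p -> door d -> incident p d ->
  (d.2 = p.2 /\ exists2 x, x \in p.1 & d.1 = p.1 :\ x) \/
  (d.1 = p.1 /\ exists2 i, i \notin p.2 & d.2 = i |: p.2).
Proof.
move=> /andP[_ /eqP cp] /and4P[_ /eqP cd _ _] inc.
have [[-> [x xd ->]]|[-> [i id ->]]] := incidentP cp cd inc; [left|right].
  split=> //; exists x; first by rewrite !inE eqxx.
  by rewrite setU1K.
split=> //; exists i; first by rewrite !inE eqxx.
by rewrite setD1K.
Qed.

(** Removing [x] from the room gives one door, and the label of [x] determines the other. That label
    differs from [k], since otherwise the room would be fully labelled. *)
Lemma card_incident_doors_aux (t : {set X}) (D : {set I}) (x : X) :
  room (t, D) -> c @: t != D -> x \in t -> door (t :\ x, D) ->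
  #|[set d | door d && incident (t, D) d]| = 2.
Proof.
move=> R nfull xt dx; have /andP[/= domt /eqP tD] := R.
have /and4P[/= _ /eqP cD kD /eqP cx] := dx.
have ccard : #|c @: (t :\ x)| = #|t :\ x|.
  rewrite cx; have := cardsD1 k D; rewrite kD cD; lia.
have cinj : {in t :\ x &, injective c} by apply/imset_injP; rewrite ccard.
have tE : t = x |: t :\ x by rewrite setD1K.
have cxk : c x != k.
  by apply: contraNneq nfull => e; rewrite tE imsetU1 cx e setD1K.
(* If [c x] is in [D] it repeats the label of a unique other point [x'], and removing [x'] gives the
   second door. If not, adding the index [c x] gives it. *)
have [cxD|cxD] := boolP (c x \in D).
  have /imsetP[x' x't cxx'] : c x \in c @: (t :\ x) by rewrite cx !inE cxk cxD.
  have /setD1P[x'x x't'] := x't.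
  have dx' : door (t :\ x', D).
    rewrite /door /= (dominantS _ _ domt) ?subsetDl // kD.
    have := cardsD1 x' t; have := cardsD1 x t; rewrite x't' xt => e1 e2.
    rewrite cD (_ : #|t :\ x| = #|t :\ x'|) ?eqxx /=; last by lia.
    apply/eqP; rewrite -cx; apply/setP => i; apply/imsetP/imsetP => -[y].
      rewrite !inE => /andP[yx' yt] ->; have [->|yx] := eqVneq y x.
        by exists x'; rewrite ?inE ?x'x.
      by exists y; rewrite ?inE ?yx.
    rewrite !inE => /andP[yx yt] ->; have [->|yx'] := eqVneq y x'.
      by exists x; rewrite ?inE ?xt ?andbT // eq_sym.
    by exists y; rewrite ?inE ?yx'.
  suff -> : [set d | door d && incident (t, D) d] = [set (t :\ x, D); (t :\ x', D)].
    rewrite cards2; suff -> : (t :\ x, D) != (t :\ x', D) by [].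
    by apply/eqP => -[] /setP/(_ x); rewrite !inE eqxx xt eq_sym x'x.
  apply/setP => d; rewrite !inE; apply/idP/idP; last first.
    by case/orP => /eqP->; rewrite ?dx ?dx' /incident /= subsetDl subxx.
  case/andP => dd inc; have /= [[d2 [y yt d1]]|[d1 [i iD d2]]] := doorP R dd inc.
    case: d d1 d2 dd inc => /= s C -> -> dd inc.
    have [->|yx] := eqVneq y x; first by rewrite eqxx.
    have [->|yx'] := eqVneq y x'; first by rewrite eqxx orbT.
    have /and4P[/= _ _ _ /eqP cy] := dd.
    have : c y \in c @: (t :\ x) by apply: imset_f; rewrite !inE yx.
    rewrite cx -cy => /imsetP[w]; rewrite !inE => /andP[wy wt] cyw.
    have [wx|wx] := eqVneq w x.
      rewrite wx cxx' in cyw; case/eqP: yx'; apply: cinj cyw => //.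
      by rewrite !inE yx.
    by case/eqP: wy; apply: cinj (esym cyw); rewrite !inE ?yx ?wx.
  case: d d1 d2 dd inc => /= s C -> -> dd inc.
  have /and4P[/= _ _ _ /eqP cy] := dd.
  have : #|c @: t| <= #|c @: (t :\ x)|.
    apply: subset_leq_card; apply/subsetP => _ /imsetP[y yt ->].
    have [->|yx] := eqVneq y x; first by rewrite cx !inE cxk.
    by apply: imset_f; rewrite !inE yx.
  rewrite cy ccard; have := cardsD1 k (i |: D); rewrite cardsU1 iD !inE kD orbT cD.
  by rewrite !add1n => -[<-]; rewrite ltnn.
have dx' : door (t, c x |: D).
  rewrite /door /= (dominantS _ _ domt) ?subsetUr // cardsU1 cxD tD !inE kD orbT /=.
  rewrite eqxx /= {1}tE imsetU1 cx; apply/eqP/setP => i; rewrite !inE.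
  by case: eqP => // ->; rewrite cxk.
suff -> : [set d | door d && incident (t, D) d] = [set (t :\ x, D); (t, c x |: D)].
  rewrite cards2; suff -> : (t :\ x, D) != (t, c x |: D) by [].
  by apply/eqP => -[] /setP/(_ x); rewrite !inE eqxx xt.
apply/setP => d; rewrite !inE; apply/idP/idP; last first.
  by case/orP => /eqP->; rewrite ?dx ?dx' /incident /= ?subsetDl ?subxx ?subsetUr.
case/andP => dd inc; have /= [[d2 [y yt d1]]|[d1 [i iD d2]]] := doorP R dd inc.
  case: d d1 d2 dd inc => /= s C -> -> dd inc.
  have [->|yx] := eqVneq y x; first by rewrite eqxx.
  have /and4P[/= _ _ _ /eqP cy] := dd.
  have : c x \in c @: (t :\ y) by apply: imset_f; rewrite !inE eq_sym yx.
  by rewrite cy !inE (negPf cxD) andbF.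
case: d d1 d2 dd inc => /= s C -> -> dd inc.
have /and4P[/= _ _ _ /eqP cy] := dd.
have : c x \in c @: t by apply: imset_f.
by rewrite cy !inE (negPf cxD) orbF => /andP[_ /eqP->]; rewrite eqxx orbT.
Qed.

(** A door obtained by adding an index [i] comes with a point labelled [i]. Removing that point
    instead gives a door too, so one incident door always leads to the situation of the previous
    lemma. *)
Lemma card_incident_doors (p : {set X} * {set I}) :
  room p -> c @: p.1 != p.2 -> ~~ odd #|[set d | door d && incident p d]|.
Proof.
case: p => t D R /= nfull; have /andP[/= domt /eqP tD] := R.
have [->|/set0Pn[d]] := eqVneq [set d | door d && incident (t, D) d] set0.
  by rewrite cards0.
rewrite inE => /andP[dd inc]; have /= [[d2 [y yt d1]]|[d1 [i iD d2]]] := doorP R dd inc.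
  rewrite (@card_incident_doors_aux t D y) //.
  by case: d d1 d2 dd inc => /= s C -> ->.
case: d d1 d2 dd inc => /= s C -> -> dd inc.
have /and4P[/= _ _ kC /eqP ct] := dd.
have ik : i != k.
  by apply: contraNneq nfull => ik; rewrite ct ik setU1K // -ik.
have kD : k \in D by move: kC; rewrite !inE eq_sym (negPf ik).
have /imsetP[x xt cx] : i \in c @: t by rewrite ct !inE ik eqxx.
have cinj : {in t &, injective c}.
  apply/imset_injP; rewrite ct; have := cardsD1 k (i |: D).
  by rewrite cardsU1 iD kC tD; lia.
rewrite (@card_incident_doors_aux t D x) //.
rewrite /door /= (dominantS _ _ domt) ?subsetDl // kD.
have := cardsD1 x t; rewrite xt -tD => -> /=; rewrite add1n eqxx /=.
apply/eqP/setP => j; apply/imsetP/setD1P => [[y]|[jk jD]].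
  rewrite !inE => /andP[yx yt] ->; have : c y \in c @: t by apply: imset_f.
  rewrite ct !inE => /andP[-> /orP[/eqP cyi|->]] //.
  by case/eqP: yx; apply: cinj => //; rewrite cyi.
have : j \in c @: t by rewrite ct !inE jk jD orbT.
case/imsetP => y yt jy; exists y => //; rewrite !inE yt andbT.
by apply: contraNneq iD => yx; rewrite cx -yx -jy.
Qed.

(** This is the exceptional door that makes the parity count fail: it opens only to the room formed
    by the [r k]-greatest point. *)
Lemma card_rooms_set0 : X -> #|[set p | room p && incident p (set0, [set k])]| = 1.
Proof.
move=> x0; pose m := [arg max_(x > x0 in X) r k x].
have mmax x : r k x <= r k m.
  by rewrite /m; case: arg_maxnP => // y _ h; apply: h.
suff -> : [set p | room p && incident p (set0, [set k])] = [set ([set m], [set k])].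
  by rewrite cards1.
apply/setP => -[t D]; rewrite !inE; apply/idP/idP; last first.
  move=> /eqP[-> ->]; rewrite /room /incident /= sub0set subxx !cards1 eqxx !andbT.
  apply/dominantP => y; exists k; rewrite ?inE // => x; rewrite inE => /eqP->.
  exact: mmax.
move=> /andP[/andP[/= /dominantP dt /eqP tD] /andP[/= _ Dk]].
have [j jD _] := dt x0.
have D1 : D = [set k].
  by apply/eqP; rewrite eqEsubset Dk sub1set; move/subsetP/(_ j jD): Dk; rewrite inE => /eqP<-.
move: tD; rewrite {jD}D1 in dt *; rewrite cards1 => /eqP/cards1P[x tx].
rewrite {}tx in dt *; suff -> : x = m by [].
apply: (@r_inj k); apply/eqP; rewrite eqn_leq mmax /=.
by have [i] := dt m; rewrite inE => /eqP-> h; apply: h; rewrite inE.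
Qed.

Theorem scarf : X -> exists s C, [/\ dominant s C, #|s| = #|C| & c @: s = C].
Proof.
move=> x0; have [/existsP[[s C] /andP[/andP[/= ? /eqP ?] /eqP ?]]|] :=
  boolP [exists p, room p && (c @: p.1 == p.2)]; first by exists s, C.
rewrite negb_exists => /forallP H; exfalso.
have odd_sum (P : pred ({set X} * {set I})) F :
    (forall p, P p -> ~~ odd (F p)) -> ~~ odd (\sum_(p | P p) F p).
  by move=> h; elim/big_rec: _ => // p m Pp; rewrite oddD => /negPf->; rewrite addbF h.
(* Incidences are counted by rooms and by doors. Without a fully labelled room the first count is
   even, while the second is odd because of the door without points. *)
have dcount : \sum_(p | room p) #|[set d | door d && incident p d]| =
    \sum_(d | door d) #|[set p | room p && incident p d]|.
  transitivity (\sum_(p | room p) \sum_(d | door d) (incident p d : nat)).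
    apply: eq_bigr => p _; rewrite -sum1dep_card big_mkcondr.
    by apply: eq_bigr => d _; case: incident.
  rewrite exchange_big; apply: eq_bigr => d _ /=.
  by rewrite -sum1dep_card [RHS]big_mkcondr; apply: eq_bigr => p _; case: incident.
have : ~~ odd (\sum_(p | room p) #|[set d | door d && incident p d]|).
  apply: odd_sum => p R; apply: card_incident_doors => //.
  by have := H p; rewrite R.
have dk : door (set0, [set k]).
  rewrite /door /= cards1 cards0 eqxx inE eqxx imset0 /= eq_sym setDv eqxx andbT.
  by apply/dominantP => y; exists k => [|x]; rewrite inE.
rewrite dcount (bigD1 _ dk) /= card_rooms_set0 // oddD negb_add /=.
apply/negP; apply: odd_sum => -[s C] /andP[dd].
have /and4P[/= dom /eqP cC kC _] := dd.
(* A door without points has a single index, which is [k]; it is the one already split off. *)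
have [s0|s0 _] := eqVneq s set0; last by rewrite card_incident_rooms.
rewrite s0 cards0 in cC *; move/eqP/cards1P: cC kC => [i ->].
by rewrite inE => /eqP->; rewrite eqxx.
Qed.

End Scarf.

(** * Scarf's theorem on the integer points of a dilated simplex *)

Section ScarfGrid.
Local Open Scope nat_scope.

(* The labelling [c] needs no boundary condition: an index that is not attained
   has [m i = 0]. *)
Lemma scarf_grid (n N : nat) (c : ('I_n.+1 -> nat) -> 'I_n.+1) :
  exists m : 'I_n.+1 -> nat, [/\ \sum_i m i <= N, N <= \sum_i m i + n &
    forall i, m i = 0 \/ exists x : 'I_n.+1 -> nat,
      [/\ \sum_j x j = N, forall j, m j <= x j & c x = i]].
Proof.
pose X : finType := {x : {ffun 'I_n.+1 -> 'I_N.+1} | \sum_i x i == N}.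
(* Points are ordered by their [i]-th coordinate; the enumeration rank, smaller than [#|X|], breaks
   ties and makes [r i] injective. *)
pose r i (x : X) := val x i * #|X| + enum_rank x.
have r_inj i : injective (r i).
  move=> x y; rewrite /r => /(congr1 (fun z => z %% #|X|)).
  by rewrite !modnMDl !modn_small // => /val_inj/enum_rank_inj.
have r_le i x y : r i x <= r i y -> val x i <= val y i.
  move=> /(leq_div2r #|X|); have X0 : 0 < #|X| by apply/card_gt0P; exists x.
  by rewrite /r !divnMDl // !divn_small // !addn0.
have mkX (x : 'I_n.+1 -> nat) : \sum_i x i = N -> exists y : X, forall i, val y i = x i :> nat.
  move=> sx; have xN i : x i < N.+1 by rewrite ltnS -sx (bigD1 i) //= leq_addr.
  pose y : {ffun 'I_n.+1 -> 'I_N.+1} := [ffun i => Ordinal (xN i)].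
  have sy : \sum_i y i == N by apply/eqP; rewrite -[RHS]sx; apply: eq_bigr => i _; rewrite ffunE.
  by exists (exist _ y sy) => i /=; rewrite ffunE.
have [x0 _] : exists y : X, forall i, val y i = (if i == ord0 then N else 0) :> nat.
  by apply: mkX; rewrite -big_mkcond big_pred1_eq.
have [s [C [/dominantP dom sC cs]]] := scarf r_inj (fun x : X => c (fun i => val x i)) ord0 x0.
have [i0 i0C _] := dom x0.
have /set0Pn[z zs] : s != set0 by rewrite -card_gt0 sC; apply/card_gt0P; exists i0.
pose mu i := [arg min_(x < z in s) r i x].
have mu_s i : mu i \in s by rewrite /mu; case: arg_minnP.
have mu_le i x : x \in s -> r i (mu i) <= r i x.
  by rewrite /mu; case: arg_minnP => // y _ h; apply: h.
pose m i := if i \in C then val (mu i) i : nat else 0.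
have m_le j x : x \in s -> m j <= val x j.
  by rewrite /m; case: ifP => // _ xs; apply/r_le/mu_le.
exists m; split.
- rewrite -[leqRHS](eqP (valP z)); apply: leq_sum => j _; exact: m_le.
(* If the minima left more than [n] units free, each coordinate in [C] could be raised by one, as
   [#|C| <= n + 1]. With the rest put on [i0], the grid point so obtained lies above all minima,
   against dominance. *)
- rewrite leqNgt; apply/negP => lt.
  pose y i := m i + (i \in C).
  have sy : \sum_i y i <= N.
    have -> : \sum_i y i = \sum_i m i + #|C|.
      rewrite big_split; congr (_ + _); rewrite -sum1_card [RHS]big_mkcond.
      by apply: eq_bigr => i _; case: (i \in C).
    apply: leq_trans lt; rewrite -addnS leq_add2l -[leqRHS]card_ord; exact: max_card.
  pose y' i := y i + (if i == i0 then N - \sum_i y i else 0).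
  have [w hw] : exists w : X, forall i, val w i = y' i :> nat.
    by apply: mkX; rewrite big_split /= -big_mkcond /= big_pred1_eq subnKC.
  have [i iC h] := dom w; have := r_le _ _ _ (h _ (mu_s i)).
  by rewrite hw /y' /y /m iC addn1 -ltnS addSn ltnS -[X in _ <= X]addn0 => h'; lia.
- move=> i; have [iC|iC] := boolP (i \in C); last by left; rewrite /m (negPf iC).
  right; move: (iC); rewrite -{1}cs => /imsetP[x xs ->].
  by exists (fun j : 'I_n.+1 => nat_of_ord (val x j)); split=> // [|j]; [exact/eqP/(valP x) | exact: m_le].
Qed.
End ScarfGrid.

From mathcomp Require Import boolp classical_sets filter.

(** * Normed spaces *)

Lemma ns_add_cancel_r (X : NormedSpace) (x y z : X) : ns_add x z = ns_add y z -> x = y.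
Proof.
move=> e; have : ns_add (ns_add x z) (ns_opp z) = ns_add (ns_add y z) (ns_opp z) by rewrite e.
by rewrite -!ns_add_assoc ns_add_opp !ns_add_zero.
Qed.

Lemma ns_add0l (X : NormedSpace) (x : X) : ns_add ns_zero x = x.
Proof. by rewrite ns_add_comm ns_add_zero. Qed.

Lemma ns_scal0 (X : NormedSpace) (x : X) : ns_scal 0 x = ns_zero.
Proof.
apply: (@ns_add_cancel_r X _ _ (ns_scal 0 x)).
by rewrite ns_add0l -ns_scal_distr_r Rplus_0_r.
Qed.

Lemma ns_scalv0 (X : NormedSpace) r : ns_scal r (ns_zero : X) = ns_zero.
Proof. by rewrite -(ns_scal0 ns_zero) ns_scal_assoc Rmult_0_r. Qed.

Lemma ns_oppE (X : NormedSpace) (x : X) : ns_opp x = ns_scal (-1) x.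
Proof.
apply: (@ns_add_cancel_r X _ _ x); rewrite ns_add_comm ns_add_opp.
rewrite -{2}(ns_scal_one _ x) -ns_scal_distr_r (_ : -1 + 1 = 0) ?ns_scal0 //; lra.
Qed.

(** Reflected linear combinations: two of them agree as soon as the coefficients of every atom do,
    which leaves only real identities to prove. *)
Inductive vexp :=
  VVar of nat | VZero | VAdd of vexp & vexp | VOpp of vexp | VScal of R & vexp.

Fixpoint veval (X : NormedSpace) (l : seq X) (e : vexp) : X :=
  match e with
  | VVar n => nth ns_zero l n
  | VZero => ns_zero
  | VAdd a b => ns_add (veval l a) (veval l b)
  | VOpp a => ns_opp (veval l a)
  | VScal r a => ns_scal r (veval l a)
  end.

Fixpoint vcoef (e : vexp) (n : nat) : R :=
  match e with
  | VVar m => if Nat.eqb m n then 1 else 0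
  | VZero => 0
  | VAdd a b => vcoef a n + vcoef b n
  | VOpp a => - vcoef a n
  | VScal r a => r * vcoef a n
  end.

Fixpoint vlin (X : NormedSpace) (l : seq X) (c : nat -> R) : X :=
  match l with
  | [::] => ns_zero
  | x :: l' => ns_add (ns_scal (c 0%N) x) (vlin l' (fun n => c n.+1))
  end.

Lemma vlin_ext (X : NormedSpace) (l : seq X) c d :
  (forall n, (n < size l)%N -> c n = d n) -> vlin l c = vlin l d.
Proof.
elim: l c d => //= x l IH c d h; rewrite (h 0%N) //; congr ns_add.
by apply: IH => n nl; apply: h.
Qed.

Lemma vlinE (X : NormedSpace) (l : seq X) (e : vexp) : veval l e = vlin l (vcoef e).
Proof.
have vlin0 l' : vlin l' (fun=> 0) = ns_zero :> X.
  by elim: l' => //= x l' IH; rewrite ns_scal0 ns_add0l.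
have vlinS l' r c : vlin l' (fun n => r * c n) = ns_scal r (vlin l' c) :> X.
  elim: l' c => [|x l' IH] c /=; first by rewrite ns_scalv0.
  by rewrite (IH (fun n => c n.+1)) ns_scal_distr_l ns_scal_assoc.
elim: e => /= [n||a -> b ->|a ->|r a ->] //.
- elim: l n => [|x l IH] [|n] //=.
    by rewrite vlin0 ns_scal_one ns_add_zero.
  by rewrite ns_scal0 ns_add0l IH.
- elim: l (vcoef a) (vcoef b) => [|x l IH] c d /=; first by rewrite ns_add_zero.
  rewrite -IH ns_scal_distr_r -!ns_add_assoc; congr ns_add.
  by rewrite !ns_add_assoc; congr ns_add; apply: ns_add_comm.
- rewrite ns_oppE -vlinS; apply: vlin_ext => n _; lra.
Qed.

Fixpoint all_lt (n : nat) (P : nat -> Prop) : Prop :=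
  match n with 0%N => True | n'.+1 => P n' /\ all_lt n' P end.

Lemma all_ltP n P : all_lt n P -> forall k, (k < n)%N -> P k.
Proof.
elim: n => // n IH [Pn h] k; rewrite ltnS leq_eqVlt => /orP[/eqP->//|]; exact: IH.
Qed.

Lemma veval_eq (X : NormedSpace) (l : seq X) (e1 e2 : vexp) :
  all_lt (size l) (fun n => vcoef e1 n = vcoef e2 n) -> veval l e1 = veval l e2.
Proof. by move=> /all_ltP h; rewrite !vlinE; apply: vlin_ext. Qed.

Ltac vmem x l :=
  match l with
  | nil => constr:(false)
  | cons x _ => constr:(true)
  | cons _ ?l' => vmem x l'
  end.
Ltac vindex x l :=
  match l with
  | cons x _ => constr:(0%N)
  | cons _ ?l' => let n := vindex x l' in constr:(S n)
  end.
Ltac vatoms t l :=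
  match t with
  | ns_zero => l
  | ns_add ?a ?b => let l1 := vatoms a l in vatoms b l1
  | ns_opp ?a => vatoms a l
  | ns_scal _ ?a => vatoms a l
  | _ => match vmem t l with true => l | false => constr:(cons t l) end
  end.
Ltac vreify t l :=
  match t with
  | ns_zero => constr:(VZero)
  | ns_add ?a ?b => let x := vreify a l in let y := vreify b l in constr:(VAdd x y)
  | ns_opp ?a => let x := vreify a l in constr:(VOpp x)
  | ns_scal ?r ?a => let x := vreify a l in constr:(VScal r x)
  | _ => let n := vindex t l in constr:(VVar n)
  end.
(* Proves equalities between linear combinations, up to ring identities or
   [field] side conditions on the coefficients. *)
Ltac vec :=
  rewrite /ns_sub;
  match goal with
  | |- @eq (ns_car ?X) ?a ?b =>
    let l0 := constr:(@nil (ns_car X)) in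
    let l1 := vatoms a l0 in
    let l := vatoms b l1 in
    let ea := vreify a l in
    let eb := vreify b l in
    apply: (@veval_eq X l ea eb); cbn -[Rplus Rmult Rminus Ropp Rdiv Rinv];
    repeat split; try ring; try (field; lra)
  end.

Section NormedSpaceTheory.
Variable X : NormedSpace.
Implicit Types x y z : X.

Lemma ns_norm0 : ns_norm (ns_zero : X) = 0.
Proof. by rewrite -(ns_scal0 ns_zero) ns_norm_scal Rabs_R0 Rmult_0_l. Qed.

Lemma ns_normN x : ns_norm (ns_opp x) = ns_norm x.
Proof. by rewrite ns_oppE ns_norm_scal Rabs_Ropp Rabs_R1 Rmult_1_l. Qed.

Lemma ns_norm_ge0 x : 0 <= ns_norm x.
Proof.
have := ns_norm_triangle _ x (ns_opp x); rewrite ns_add_opp ns_norm0 ns_normN; lra.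
Qed.

Lemma ns_distC x y : ns_norm (ns_sub x y) = ns_norm (ns_sub y x).
Proof. by rewrite -ns_normN; congr ns_norm; vec. Qed.

Lemma ns_dist_triangle y x z :
  ns_norm (ns_sub x z) <= ns_norm (ns_sub x y) + ns_norm (ns_sub y z).
Proof.
rewrite (_ : ns_sub x z = ns_add (ns_sub x y) (ns_sub y z)); last by vec.
exact: ns_norm_triangle.
Qed.

Lemma ns_norm_sub x y : ns_norm (ns_sub x y) <= ns_norm x + ns_norm y.
Proof. by rewrite -(ns_normN y); apply: ns_norm_triangle. Qed.

Lemma ns_norm_le_dist x y : ns_norm x <= ns_norm (ns_sub x y) + ns_norm y.
Proof.
by rewrite {1}(_ : x = ns_add (ns_sub x y) y); [apply: ns_norm_triangle | vec].
Qed.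

Lemma ns_scal_pos r x : 0 <= r -> ns_norm (ns_scal r x) = r * ns_norm x.
Proof. by move=> r0; rewrite ns_norm_scal Rabs_right //; lra. Qed.

Lemma ns_sub_self x : ns_sub x x = ns_zero.
Proof. exact: ns_add_opp. Qed.

Lemma ns_sub_eq0 x y : ns_norm (ns_sub x y) <= 0 -> x = y.
Proof.
move=> h; have /ns_norm_eq0 e : ns_norm (ns_sub x y) = 0 by have := ns_norm_ge0 (ns_sub x y); lra.
have -> : x = ns_add (ns_sub x y) y by vec.
by rewrite e ns_add0l.
Qed.

End NormedSpaceTheory.

Section Dual.
Variables (X : NormedSpace) (f : X -> R).
Hypothesis fdual : in_dual f.
Implicit Types x y : X.

Lemma dualD x y : f (ns_add x y) = f x + f y.
Proof. by case: fdual. Qed.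
Lemma dualZ r x : f (ns_scal r x) = r * f x.
Proof. by case: fdual => _ []. Qed.
Lemma dualN x : f (ns_opp x) = - f x.
Proof. rewrite ns_oppE dualZ; ring. Qed.
Lemma dualB x y : f (ns_sub x y) = f x - f y.
Proof. rewrite dualD dualN; ring. Qed.
Lemma dual0 : f ns_zero = 0.
Proof. rewrite -(ns_scal0 ns_zero) dualZ; ring. Qed.
Lemma dual_bound : exists c, 0 <= c /\ functional_bounded_by f c.
Proof.
case: fdual => _ [_ [c hc]]; exists (Rmax c 0); split; first exact: Rmax_r.
move=> x; apply: Rle_trans (hc x) _; apply: Rmult_le_compat_r; first exact: ns_norm_ge0.
exact: Rmax_l.
Qed.
Lemma dual_le c x : functional_bounded_by f c -> f x <= c * ns_norm x.
Proof. by move=> h; apply: Rle_trans (h x); apply: Rle_abs. Qed.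

End Dual.

(** * Hahn-Banach *)

Definition convexR (X : NormedSpace) (p : X -> R) :=
  forall x y t, 0 <= t <= 1 ->
    p (ns_add (ns_scal t x) (ns_scal (1 - t) y)) <= t * p x + (1 - t) * p y.

Section HahnBanach.
Variables (X : NormedSpace) (p : X -> R).
Hypothesis (p_cvx : convexR p) (p0 : p ns_zero = 0).

(** Partial functionals are encoded by their graphs, so that extension is inclusion and Zorn's lemma
    applies to unions. Single-valuedness is not imposed; it follows from [p ns_zero = 0], because a
    difference of two values at one point is a value at zero. *)
Definition linear_minorant (G : set (X * R)) :=
  [/\ forall x y r s, G (x, r) -> G (y, s) -> G (ns_add x y, r + s),
      forall c x r, G (x, r) -> G (ns_scal c x, c * r) &
      forall x r, G (x, r) -> r <= p x].

Lemma linear_minorant_extend (G : set (X * R)) (x : X) :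
  linear_minorant G -> G (ns_zero, 0) -> exists a : R,
    linear_minorant (fun q => exists g r t,
      G (g, r) /\ q = (ns_add g (ns_scal t x), r + t * a)).
Proof.
move=> [GD GZ Gp] G0.
(* The two one-sided bounds on the new value [a] are compatible by convexity of
   [p] at the convex combination of [g + t x] and [g' - s x] free of [x]. *)
have compat g r t g' r' s : 0 < t -> 0 < s -> G (g, r) -> G (g', r') ->
    (r' - p (ns_sub g' (ns_scal s x))) / s <= (p (ns_add g (ns_scal t x)) - r) / t.
  move=> t0 s0 Gg Gg'; have st : 0 < s + t by lra.
  have := @p_cvx (ns_add g (ns_scal t x)) (ns_sub g' (ns_scal s x)) (s / (s + t)).
  rewrite (_ : ns_add _ _ = ns_add (ns_scal (s / (s + t)) g) (ns_scal (t / (s + t)) g')); last first.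
    by vec.
  have l01 : 0 <= s / (s + t) <= 1.
    have := Rdiv_lt_0_compat _ _ s0 st; have := Rdiv_lt_0_compat _ _ t0 st.
    have : s / (s + t) + t / (s + t) = 1 by field; lra.
    lra.
  move=> /(_ l01) h.
  have := Gp _ _ (GD _ _ _ _ (GZ (s / (s + t)) _ _ Gg) (GZ (t / (s + t)) _ _ Gg')).
  move=> /Rle_trans/(_ h){h}.
  set P := p (ns_add g _); set Q := p (ns_sub g' _) => h.
  have {h} : s * r + t * r' <= s * P + t * Q.
    move/(Rmult_le_compat_l (s + t) _ _ (Rlt_le _ _ st)): h.
    rewrite (_ : _ * (_ + _) = s * r + t * r'); last by field; lra.
    by rewrite (_ : _ * (_ + _) = s * P + t * Q) //; field; lra.
  move=> h; apply: (Rmult_le_reg_r (s * t)); first exact: Rmult_lt_0_compat.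
  rewrite (_ : _ / s * _ = t * (r' - Q)); last by field; lra.
  rewrite (_ : _ / t * _ = s * (P - r)); last by field; lra.
  lra.
pose E (a : R) := exists g r s, [/\ 0 < s, G (g, r) & a = (r - p (ns_sub g (ns_scal s x))) / s].
have [a [Ea aE]] : {a | is_lub E a}.
  apply: completeness.
    exists ((p (ns_add ns_zero (ns_scal 1 x)) - 0) / 1) => _ [g [r [s [s0 Gg ->]]]].
    by apply: compat => //; lra.
  by exists ((0 - p (ns_sub ns_zero (ns_scal 1 x))) / 1), ns_zero, 0, 1; split => //; lra.
exists a; split.
- move=> _ _ _ _ [g [r [t [Gg [-> ->]]]]] [g' [r' [t' [Gg' [-> ->]]]]].
  exists (ns_add g g'), (r + r'), (t + t'); split; first exact: GD.
  by congr pair; [vec | ring].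
- move=> c _ _ [g [r [t [Gg [-> ->]]]]]; exists (ns_scal c g), (c * r), (c * t).
  by split; [exact: GZ | congr pair; [vec | ring]].
- move=> _ _ [g [r [t [Gg [-> ->]]]]].
  have [t0|[->|t0]] := Rtotal_order t 0.
  + have : (r - p (ns_sub g (ns_scal (- t) x))) / (- t) <= a.
      by apply: Ea; exists g, r, (- t); split => //; lra.
    rewrite (_ : ns_sub _ _ = ns_add g (ns_scal t x)); last by vec.
    set P := p _ => h; have t0' : 0 <= - t by lra.
    move/(Rmult_le_compat_l _ _ _ t0'): h.
    rewrite (_ : - t * (_ / _) = r - P); last by field; lra.
    lra.
  + by rewrite ns_scal0 ns_add_zero Rmult_0_l Rplus_0_r; apply: Gp.
  + have : a <= (p (ns_add g (ns_scal t x)) - r) / t.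
      by apply: aE => _ [g' [r' [s [s0 Gg' ->]]]]; apply: compat.
    set P := p _ => /(Rmult_le_compat_l t _ _ (Rlt_le _ _ t0)).
    rewrite (_ : t * (_ / _) = P - r); last by field; lra.
    lra.
Qed.

Lemma hahn_banach0 : exists f : X -> R,
  [/\ forall x y, f (ns_add x y) = f x + f y,
      forall r x, f (ns_scal r x) = r * f x & forall x, f x <= p x].
Proof.
have [G [GP Gmax]] : exists G, linear_minorant G /\
    forall G', (G `<` G')%classic -> ~ linear_minorant G'.
  apply: Zorn_bigcup => F FP Ftot; split.
  - move=> x y r s [G1 FG1 G1x] [G2 FG2 G2y].
    have [G12|G21] := Ftot _ _ FG1 FG2.
      by exists G2 => //; have [h _ _] := FP _ FG2; apply: h => //; apply: G12.
    by exists G1 => //; have [h _ _] := FP _ FG1; apply: h => //; apply: G21.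
  - by move=> c x r [G1 FG1 G1x]; exists G1 => //; have [_ h _] := FP _ FG1; apply: h.
  - by move=> x r [G1 FG1 G1x]; have [_ _ h] := FP _ FG1; apply: h.
(* The empty graph is also a linear minorant, but it is not maximal, since the graph of the zero
   functional on the zero space extends it. *)
have G0 : G (ns_zero, 0).
  have [[[g r] Gg]|h] := pselect (exists q, G q).
    have [_ GZ _] := GP; have := GZ 0 _ _ Gg.
    by rewrite ns_scal0 Rmult_0_l.
  exfalso; apply: (Gmax [set (ns_zero, 0)]%classic).
    split; first by move=> q Gq; exfalso; apply: h; exists q.
    by move=> /(_ (ns_zero, 0) erefl) Gq; apply: h; exists (ns_zero, 0).
  split.
  - by move=> x y r s [-> ->] [-> ->]; rewrite ns_add_zero Rplus_0_r.
  - by move=> c x r [-> ->]; rewrite ns_scalv0 Rmult_0_r.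
  - by move=> x r [-> ->]; rewrite p0; lra.
have Gtot x : exists r, G (x, r).
  apply: contrapT => h; have [a Ha] := linear_minorant_extend x GP G0.
  apply: Gmax Ha; split.
    move=> [g r] Gg; exists g, r, 0; split => //.
    by rewrite ns_scal0 ns_add_zero Rmult_0_l Rplus_0_r.
  move=> /(_ (x, a)) Gx; apply: h; exists a; apply: Gx.
  exists ns_zero, 0, 1; split => //.
  by rewrite ns_scal_one ns_add0l Rmult_1_l Rplus_0_l.
have [GD GZ Gp] := GP.
have uniq x r s : G (x, r) -> G (x, s) -> r <= s.
  move=> Gr Gs; have := GD _ _ _ _ Gr (GZ (-1) _ _ Gs).
  rewrite (_ : ns_add _ _ = ns_zero); last by vec.
  by move=> /Gp; rewrite p0; lra.
have [f Hf] := choice Gtot.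
have fE x r : G (x, r) -> f x = r.
  by move=> Gx; apply: Rle_antisym; apply: uniq Gx || apply: (uniq _ _ _ Gx).
exists f; split => [x y|r x|x].
- by apply: fE; apply: GD.
- by apply: fE; apply: GZ.
- exact: Gp.
Qed.

End HahnBanach.

Lemma le_eps a b : (forall e, 0 < e -> a <= b + e) -> a <= b.
Proof. by move=> h; apply: Rnot_lt_le => ba; have := h ((a - b) / 2); lra. Qed.

Lemma inv_INR_lt (e : R) : 0 < e -> exists N, forall n, (N <= n)%N -> / INR n.+1 < e.
Proof.
move=> e0; have [N [hN N0]] := archimed_cor1 e e0; exists N => n Nn.
apply: Rle_lt_trans hN; apply: Rinv_le_contravar; first exact: lt_0_INR.
by apply: le_INR; apply/leP; apply: leq_trans Nn _.
Qed.

Lemma inv_INR_gt0 n : 0 < / INR n.+1.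
Proof. by apply: Rinv_0_lt_compat; apply: lt_0_INR; apply/ltP. Qed.

Lemma inf_exists (E : R -> Prop) b : (exists x, E x) -> (forall x, E x -> b <= x) ->
  exists d, (forall x, E x -> d <= x) /\ forall e, 0 < e -> exists x, E x /\ x < d + e.
Proof.
move=> [x0 Ex0] Eb.
have [a [Ea aE]] : {a | is_lub (fun y => E (- y)) a}.
  apply: completeness; last by exists (- x0); rewrite Ropp_involutive.
  by exists (- b) => y /Eb; lra.
exists (- a); split=> [x Ex|e e0].
  by have : - x <= a; [apply: Ea; rewrite Ropp_involutive | lra].
apply: contrapT => h; have : a <= a - e; last lra.
by apply: aE => y Ey; apply: Rnot_lt_le => ye; apply: h; exists (- y); split=> //; lra.
Qed.

(** * Separation of points from closed convex sets *)

Section Separation.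
Variable X : NormedSpace.
Implicit Types (x y v : X) (S : X -> Prop).

(** Hahn-Banach below [p v - p ns_zero]; the bound at [- x] controls [f x] from below. With [p] a
    translated distance or a translated norm it yields separating and norming functionals. *)
Lemma subgradient (p : X -> R) : convexR p ->
  (forall v, p v - p ns_zero <= ns_norm v) ->
  exists f, [/\ in_dual f, functional_bounded_by f 1 & forall v, f v <= p v - p ns_zero].
Proof.
move=> pc pl; have [||f [fD fZ fp]] := @hahn_banach0 X (fun v => p v - p ns_zero); [|lra|].
  by move=> x y t t01; have := pc x y t t01; lra.
have fb : functional_bounded_by f 1.
  move=> x; rewrite Rmult_1_l; apply: Rabs_le; split; last by have := fp x; have := pl x; lra.
  have := fp (ns_opp x); have := pl (ns_opp x).
  by rewrite ns_normN {2}ns_oppE fZ; lra.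
by exists f; split => //; split=> //; split => //; exists 1.
Qed.

Lemma dist_exists S : ne_set S -> forall x, exists d, [/\ 0 <= d,
  forall y, S y -> d <= ns_norm (ns_sub x y) &
  forall e, 0 < e -> exists y, S y /\ ns_norm (ns_sub x y) < d + e].
Proof.
move=> [y0 Sy0] x.
have [||d [dE dlt]] := @inf_exists (fun r => exists y, S y /\ r = ns_norm (ns_sub x y)) 0.
- by exists (ns_norm (ns_sub x y0)), y0.
- by move=> _ [y [_ ->]]; apply: ns_norm_ge0.
exists d; split.
- apply: le_eps => e e0; have [_ [[y [_ ->]] h]] := dlt e e0.
  by have := ns_norm_ge0 (ns_sub x y); lra.
- by move=> y Sy; apply: dE; exists y.
- by move=> e e0; have [_ [[y [Sy ->]] h]] := dlt e e0; exists y.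
Qed.

(** The distance to [S] is convex and 1-Lipschitz. A subgradient of it at [x], evaluated at [y - x]
    for [y] in [S], is at most minus the distance, which is positive as [S] is closed. *)
Lemma convex_dist_sep S x : ne_set S -> closedS S -> convexS S -> ~ S x ->
  exists f e, [/\ in_dual f, 0 < e & forall y, S y -> f y + e <= f x].
Proof.
move=> Sne Scl Scv Sx; have [d dP] := choice (dist_exists Sne).
have dx0 : 0 < d x.
  have [d0 _ dlt] := dP x; apply: Rnot_le_lt => dx; apply: Sx.
  have /choice[u uP] : forall n, exists y, S y /\ ns_norm (ns_sub x y) < / INR n.+1.
    by move=> n; have [y [Sy hy]] := dlt _ (inv_INR_gt0 n); exists y; split => //; lra.
  apply: (Scl u) => [n|e e0]; first by have [] := uP n.
  have [N hN] := inv_INR_lt e0; exists N => n /leP Nn; rewrite ns_distC.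
  by have [_ h] := uP n; have := hN n Nn; lra.
have [||f [fd _ fp]] := @subgradient (fun v => d (ns_add x v)).
- move=> v w t t01; apply: le_eps => e e0.
  have [_ _ /(_ e e0)[y [Sy hy]]] := dP (ns_add x v).
  have [_ _ /(_ e e0)[z [Sz hz]]] := dP (ns_add x w).
  have [_ h _] := dP (ns_add x (ns_add (ns_scal t v) (ns_scal (1 - t) w))).
  apply: Rle_trans (h _ (Scv _ _ _ Sy Sz t01)) _.
  rewrite (_ : ns_sub _ _ = ns_add (ns_scal t (ns_sub (ns_add x v) y))
    (ns_scal (1 - t) (ns_sub (ns_add x w) z))); last by vec.
  apply: Rle_trans (ns_norm_triangle _ _ _) _; rewrite !ns_scal_pos; try lra.
  by nra.
- move=> v; rewrite ns_add_zero; have : d (ns_add x v) <= d x + ns_norm v; last lra.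
  apply: le_eps => e e0; have [_ _ /(_ e e0)[y [Sy hy]]] := dP x.
  have [_ /(_ y Sy) h _] := dP (ns_add x v).
  have := ns_norm_triangle _ (ns_sub x y) v.
  rewrite (_ : ns_add _ v = ns_sub (ns_add x v) y); last by vec.
  lra.
exists f, (d x); split => // y Sy; have := fp (ns_sub y x); rewrite dualB // ns_add_zero.
rewrite (_ : ns_add x _ = y); last by vec.
have [_ /(_ y Sy)] := dP y; rewrite ns_sub_self ns_norm0; lra.
Qed.

Lemma norming_functional x :
  exists f, [/\ in_dual f, functional_bounded_by f 1 & f x = ns_norm x].
Proof.
have [||f [fd fb fp]] := @subgradient (fun v => ns_norm (ns_add x v)).
- move=> v w t t01.
  rewrite (_ : ns_add x _ = ns_add (ns_scal t (ns_add x v)) (ns_scal (1 - t) (ns_add x w))); last by vec.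
  by apply: Rle_trans (ns_norm_triangle _ _ _) _; rewrite !ns_scal_pos; lra.
- by move=> v; rewrite ns_add_zero; have := ns_norm_triangle _ x v; lra.
exists f; split => //; apply: Rle_antisym; first by have := dual_le x fb; lra.
have := fp (ns_opp x); rewrite dualN // ns_add_opp ns_norm0 ns_add_zero; lra.
Qed.

(* Weak adherence along each functional separately is enough here, because
   a point outside a closed convex set is separated by one functional. *)
Lemma mazur S x : closedS S -> convexS S ->
  (forall f, in_dual f -> forall e, 0 < e -> exists y, S y /\ Rabs (f y - f x) < e) -> S x.
Proof.
move=> Scl Scv H; apply: contrapT => Sx.
have Sne : ne_set S.
  have d0 : in_dual (fun _ : X => 0).
    split=> [x' y'|]; first lra; split=> [r x'|]; first lra.
    by exists 0 => x'; rewrite Rabs_R0 Rmult_0_l; lra.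
  by have [|y [Sy _]] := H _ d0 1; [lra | exists y].
have [f [e [fd e0 fS]]] := convex_dist_sep Sne Scl Scv Sx.
have [y [Sy]] := H f fd e e0; have := fS y Sy.
by move=> h /Rabs_def2; lra.
Qed.

Lemma weak_cv_closed S (u : nat -> X) x : closedS S -> convexS S ->
  (forall n, S (u n)) -> weak_cv u x -> S x.
Proof.
move=> Scl Scv Su ux; apply: mazur => // f fd e e0.
by have [N hN] := ux f fd e e0; exists (u N); split => //; apply: hN; exact: le_n.
Qed.

End Separation.

(** * Weak compactness *)

Section UltraLimit.
Variables (I : Type) (G : set (set I)).
Hypothesis GU : UltraFilter G.

Definition ultra_lim (a : I -> R) (l : R) :=
  forall e, 0 < e -> G [set i | Rabs (a i - l) < e]%classic.

(** The limit is the supremum of the levels [r] for which [r <= a i] holds on a member of [G];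
    slightly above it, the complement belongs to the ultrafilter. *)
Lemma ultra_lim_exists (a : I -> R) (M : R) :
  (forall i, Rabs (a i) <= M) -> exists l, ultra_lim a l.
Proof.
move=> aM; pose E r := G [set i | r <= a i]%classic.
have aM' i : - M <= a i <= M by move: (aM i); rewrite /Rabs; case: Rcase_abs => *; lra.
have [l [El lE]] : {l | is_lub E l}.
  apply: completeness; last by exists (- M); apply: filterS filterT => i _ /=; have := aM' i; lra.
  exists M => r /filter_ex[i /= ri]; have := aM' i; lra.
exists l => e e0.
have [r [Er lr]] : exists r, E r /\ l - e < r.
  apply: contrapT => h; have : l <= l - e; last lra.
  by apply: lE => r Er; apply: Rnot_lt_le => lr; apply: h; exists r.
have [h|h] := in_ultra_setVsetC [set i | l + e / 2 <= a i]%classic GU.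
  by have := El _ h; lra.
apply: filterS (filterI Er h) => i [/= ri /Rnot_le_lt la]; apply: Rabs_def1; lra.
Qed.

Lemma ultra_lim_unique (a : I -> R) l l' : ultra_lim a l -> ultra_lim a l' -> l = l'.
Proof.
move=> h h'; apply: contrapT => ll.
have e0 : 0 < Rabs (l - l') / 2 by have := Rabs_pos_lt (l - l'); lra.
have [i [/= h1 h2]] := filter_ex (filterI (h _ e0) (h' _ e0)).
have := Rabs_triang (a i - l') (- (a i - l)); rewrite Rabs_Ropp.
rewrite (_ : _ + _ = l - l'); last ring; lra.
Qed.

Lemma ultra_limD (a b : I -> R) l l' : ultra_lim a l -> ultra_lim b l' ->
  ultra_lim (fun i => a i + b i) (l + l').
Proof.
move=> h h' e e0; have e2 : 0 < e / 2 by lra.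
apply: filterS (filterI (h _ e2) (h' _ e2)) => i [/= h1 h2].
rewrite (_ : _ - _ = (a i - l) + (b i - l')); last ring.
by apply: Rle_lt_trans (Rabs_triang _ _) _; lra.
Qed.

Lemma ultra_limZ (a : I -> R) l r : ultra_lim a l -> ultra_lim (fun i => r * a i) (r * l).
Proof.
move=> h e e0; have r0 := Rabs_pos r; have e2 : 0 < e / (Rabs r + 1) by apply: Rdiv_lt_0_compat; lra.
apply: filterS (h _ e2) => i /= h1; rewrite -Rmult_minus_distr_l Rabs_mult.
have := Rmult_lt_compat_r (Rabs r + 1) _ _ _ h1.
rewrite (_ : e / _ * _ = e); last by field; lra.
by move=> /(_ ltac:(lra)); have := Rabs_pos (a i - l); nra.
Qed.

(** The assignment of [lim f (u i)] to [f] is linear and bounded by [M] on the dual, so reflexivity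
    represents it by a point. *)
Lemma weak_ultra_lim (V : NormedSpace) (u : I -> V) (M : R) : reflexive V ->
  (forall i, ns_norm (u i) <= M) ->
  exists x, forall f, in_dual f -> ultra_lim (fun i => f (u i)) (f x).
Proof.
move=> refl uM.
have bnd f c : 0 <= c -> functional_bounded_by f c -> forall i, Rabs (f (u i)) <= c * M.
  by move=> c0 fc i; apply: Rle_trans (fc _) _; apply: Rmult_le_compat_l.
(* Functionals are plain functions here, so outside the dual a dummy value 0 keeps the choice
   function total. *)
have ex f : exists l, in_dual f -> ultra_lim (fun i => f (u i)) l.
  have [fd|nf] := pselect (in_dual f); last by exists 0.
  have [c [c0 fc]] := dual_bound fd.
  by have [l hl] := ultra_lim_exists (bnd f c c0 fc); exists l.
have [Phi PhiP] := choice ex.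
have [|||x xP] := refl Phi; last by exists x => f fd; rewrite -xP //; apply: PhiP.
- move=> f g fd gd; apply: (ultra_lim_unique (PhiP _ _)); last by apply: ultra_limD; apply: PhiP.
  case: (fd) => fD [fZ [c fc]]; case: (gd) => gD [gZ [c' gc]]; split=> [x y|].
    by rewrite fD gD; lra.
  split=> [r x|]; first by rewrite fZ gZ; lra.
  exists (c + c') => x; apply: Rle_trans (Rabs_triang _ _) _.
  by have := fc x; have := gc x; lra.
- move=> r f fd; apply: (ultra_lim_unique (PhiP _ _)); last by apply: ultra_limZ; apply: PhiP.
  case: (fd) => fD [fZ [c fc]]; split=> [x y|]; first by rewrite fD; lra.
  split=> [s x|]; first by rewrite fZ; ring.
  exists (Rabs r * c) => x; rewrite Rabs_mult Rmult_assoc.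
  by apply: Rmult_le_compat_l; [apply: Rabs_pos | apply: fc].
- exists M => f c fd c0 fc; rewrite Rmult_comm; apply: le_eps => e e0.
  have [i /= h] := filter_ex (PhiP f fd e e0).
  have := bnd f c c0 fc i; have := Rabs_triang_inv (Phi f) (f (u i)).
  by rewrite Rabs_minus_sym in h; lra.
Qed.

End UltraLimit.

Section Subsequences.

Definition subseq_index (h : nat -> nat) := forall n, (h n < h n.+1)%N.

Lemma subseq_index_ge h n : subseq_index h -> (n <= h n)%N.
Proof. by move=> hh; elim: n => // n IH; apply: leq_ltn_trans IH (hh n). Qed.

Lemma subseq_index_comp h g : subseq_index h -> subseq_index g -> subseq_index (h \o g).
Proof.
move=> hh gg n /=; have mono m k : (h m < h (k.+1 + m))%N.
  by elim: k => // k IH; apply: ltn_trans IH (hh _).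
by have := mono (g n) (g n.+1 - (g n).+1)%N; rewrite addSnnS subnK.
Qed.

Lemma Un_cv_subseq a l h : subseq_index h -> Un_cv a l -> Un_cv (fun n => a (h n)) l.
Proof.
move=> hh al e e0; have [N hN] := al e e0; exists N => n Nn; apply: hN.
by apply/leP; apply: leq_trans (subseq_index_ge n hh); apply/leP.
Qed.

Lemma weak_cv_subseq (V : NormedSpace) (u : nat -> V) x h :
  subseq_index h -> weak_cv u x -> weak_cv (fun n => u (h n)) x.
Proof. by move=> hh ux f fd; apply: (Un_cv_subseq hh (ux f fd)). Qed.

Lemma ns_cv_subseq (V : NormedSpace) (u : nat -> V) x h :
  subseq_index h -> ns_cv u x -> ns_cv (fun n => u (h n)) x.
Proof.
move=> hh ux e e0; have [N hN] := ux e e0; exists N => n Nn; apply: hN.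
by apply/leP; apply: leq_trans (subseq_index_ge n hh); apply/leP.
Qed.

Lemma subseq_exists (Q : nat -> nat -> Prop) :
  (forall k N, exists n, (N <= n)%N /\ Q k n) ->
  exists h, subseq_index h /\ forall n, Q n (h n).
Proof.
move=> H; have /choice[g gP] : forall q : nat * nat, exists n, (q.2 <= n)%N /\ Q q.1 n.
  by move=> [k N]; apply: H.
pose h := fix h n := match n with 0%N => g (0%N, 0%N) | n'.+1 => g (n'.+1, (h n').+1) end.
by exists h; split => [n|[|n]] /=; [case: (gP (n.+1, (h n).+1)) | case: (gP (0%N, 0%N)) | case: (gP (n.+1, (h n).+1))].
Qed.

(** The Fréchet filter; limits along an ultrafilter above it are cluster values of the sequence. *)
Definition tails : set (set nat) := fun P => exists N, forall n, (N <= n)%N -> P n.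

Lemma tails_ultra : exists G : set (set nat), UltraFilter G /\ (tails `<=` G)%classic.
Proof.
apply: ultraFilterLemma; apply: Build_ProperFilter_ex.
  by move=> P [N hN]; exists N; apply: hN.
split; first by exists 0%N.
- move=> P Q [N hN] [M hM]; exists (maxn N M) => n; rewrite geq_max => /andP[? ?].
  by split; [apply: hN | apply: hM].
- by move=> P Q PQ [N hN]; exists N => n /hN; apply: PQ.
Qed.

Lemma ns_cv_weak (V : NormedSpace) (u : nat -> V) x : ns_cv u x -> weak_cv u x.
Proof.
move=> ux f fd e e0; have [c [c0 fc]] := dual_bound fd.
have [|N hN] := ux (e / (c + 1)); first by apply: Rdiv_lt_0_compat; lra.
exists N => n /hN h; rewrite /R_dist -dualB //; apply: Rle_lt_trans (fc _) _.
have := Rmult_lt_compat_r (c + 1) _ _ _ h; rewrite (_ : e / _ * _ = e); last by field; lra.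
by move=> /(_ ltac:(lra)); have := ns_norm_ge0 (ns_sub (u n) x); nra.
Qed.

End Subsequences.

(** * Separable convex sets *)

Section CountableHull.
Variable V : NormedSpace.
Implicit Types x y : V.

Definition mid x y := ns_add (ns_scal (/ 2) x) (ns_scal (/ 2) y).

(** Bisection: a point of the segment lies in one of its halves, whose ends [mid x y] and [x] or [y]
    are in [S], and each pass halves the error. This lets a countable family closed under midpoints
    alone have a convex closure. *)
Lemma midpoint_closed_convex (S : V -> Prop) : closedS S ->
  (forall x y, S x -> S y -> S (mid x y)) -> convexS S.
Proof.
move=> Scl Smid x y t Sx Sy t01.
have approx n : forall x y t, S x -> S y -> 0 <= t <= 1 -> exists z, S z /\
    ns_norm (ns_sub z (ns_add (ns_scal t x) (ns_scal (1 - t) y))) <= (/ 2) ^ n * ns_norm (ns_sub x y).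
  elim: n => [|n IH] {Sx Sy t01}x {}y {}t Sx Sy t01.
    exists y; split=> //; rewrite Rmult_1_l.
    rewrite (_ : ns_sub y _ = ns_scal t (ns_sub y x)); last by vec.
    by rewrite ns_scal_pos ?(ns_distC y x); [have := ns_norm_ge0 (ns_sub x y); nra | lra].
  have half w : ns_norm (ns_sub (mid x y) w) = ns_norm (ns_scal (/2) (ns_sub x y)) ->
     (/2) ^ n * ns_norm (ns_sub (mid x y) w) = (/ 2) ^ n.+1 * ns_norm (ns_sub x y).
    by move=> ->; rewrite ns_scal_pos /=; [ring | lra].
  have [t2|t2] := Rle_lt_dec t (/2).
    have [|z [Sz hz]] := IH (mid x y) y (2 * t) (Smid _ _ Sx Sy) Sy; first lra.
    exists z; split=> //; rewrite -(half y); last by congr ns_norm; rewrite /mid; vec.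
    by move: hz; congr (ns_norm (ns_sub z _) <= _); rewrite /mid; vec.
  have [|z [Sz hz]] := IH (mid x y) x (2 * (1 - t)) (Smid _ _ Sx Sy) Sx; first lra.
  exists z; split=> //; rewrite -(half x); last first.
    by rewrite ns_distC; congr ns_norm; rewrite /mid; vec.
  by move: hz; congr (ns_norm (ns_sub z _) <= _); rewrite /mid; vec.
have /choice[z zP] := fun n => approx n _ _ _ Sx Sy t01.
apply: (Scl z) => [n|e e0]; first by have [] := zP n.
have d0 := ns_norm_ge0 (ns_sub x y).
have [||N hN] := pow_lt_1_zero (/2) _ (e / (ns_norm (ns_sub x y) + 1)).
  by rewrite Rabs_right; lra.
  by apply: Rdiv_lt_0_compat; lra.
exists N => n /hN; rewrite Rabs_right; last by apply/Rle_ge/pow_le; lra.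
move=> /(Rmult_lt_compat_r (ns_norm (ns_sub x y) + 1) _ _ ltac:(lra)).
rewrite (_ : e / _ * _ = e); last by field; lra.
have [_] := zP n; have : 0 <= (/ 2) ^ n by apply: pow_le; lra.
by move=> h1 h2 h3; lra.
Qed.

Section Terms.
Variables (p : nat -> V) (s : V -> V).

Fixpoint term_eval (t : GenTree.tree nat) : V :=
  match t with
  | GenTree.Leaf n => p n
  | GenTree.Node _ [:: a] => s (term_eval a)
  | GenTree.Node _ [:: a; b] => mid (term_eval a) (term_eval b)
  | _ => p 0
  end.

Lemma countable_hull : exists e : nat -> V,
  [/\ forall n, exists m, e m = p n,
      forall n, exists m, e m = s (e n),
      forall i j, exists m, e m = mid (e i) (e j) &
      forall P : V -> Prop, (forall n, P (p n)) -> (forall x, P x -> P (s x)) ->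
        (forall x y, P x -> P y -> P (mid x y)) -> forall n, P (e n)].
Proof.
pose T : countType := GenTree.tree nat.
pose e n := if unpickle n is Some t then term_eval (t : T) else p 0.
have eP (t : T) : e (pickle t) = term_eval t by rewrite /e pickleK.
have eT n : exists t : T, e n = term_eval t.
  by rewrite /e; case: unpickle => [t|]; [exists t | exists (GenTree.Leaf 0%N)].
exists e; split.
- by move=> n; exists (pickle (GenTree.Leaf n : T)); rewrite eP.
- move=> n; have [t ->] := eT n; exists (pickle (GenTree.Node 0 [:: t] : T)); by rewrite eP.
- move=> i j; have [a ->] := eT i; have [b ->] := eT j.
  by exists (pickle (GenTree.Node 0 [:: a; b] : T)); rewrite eP.
- move=> P Pp Ps Pm n; have [t ->] := eT n.
  have : P (term_eval t); last by [].
  move: t; fix IH 1 => -[k|k [|a [|b [|? ?]]]] /=; try exact: Pp.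
  + by apply/Ps/IH.
  + by apply: Pm; apply: IH.
Qed.

End Terms.

Definition closureS (e : nat -> V) x := forall eps, 0 < eps -> exists n, ns_norm (ns_sub x (e n)) < eps.

Lemma closureS_seq (e : nat -> V) n : closureS e (e n).
Proof. by move=> eps e0; exists n; rewrite ns_sub_self ns_norm0. Qed.

Lemma closureS_closed (e : nat -> V) : closedS (closureS e).
Proof.
move=> u l ue ul eps e0; have [|N hN] := ul (eps / 2); first lra.
have [|n hn] := ue N (eps / 2); first lra.
exists n; have := ns_dist_triangle (u N) l (e n); have := hN N (le_n _).
by rewrite ns_distC; lra.
Qed.

Lemma closureS_convex (e : nat -> V) :
  (forall i j, exists m, e m = mid (e i) (e j)) -> convexS (closureS e).
Proof.
move=> emid; apply: midpoint_closed_convex; first exact: closureS_closed.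
move=> x y xe ye eps e0; have [n hn] := xe eps e0; have [k hk] := ye eps e0.
have [m em] := emid n k; exists m; rewrite em.
rewrite (_ : ns_sub _ _ = ns_add (ns_scal (/2) (ns_sub x (e n))) (ns_scal (/2) (ns_sub y (e k)))); last first.
  by rewrite /mid; vec.
by apply: Rle_lt_trans (ns_norm_triangle _ _ _) _; rewrite !ns_scal_pos; lra.
Qed.

(** The functionals norm the differences [e i - e j]. If they agree at [x] and [y], and [e i], [e j]
    approximate these points, then the norm of [e i - e j] equals [f (e i - x) + f (y - e j)], which
    is small. *)
Lemma separating_sequence (e : nat -> V) : exists g : nat -> V -> R,
  (forall k, in_dual (g k)) /\
  forall x y, closureS e x -> closureS e y -> (forall k, g k x = g k y) -> x = y.
Proof.
have [J JP] := choice (@norming_functional V).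
pose g k := if unpickle k is Some (i, j) then J (ns_sub (e i) (e j)) else J ns_zero.
exists g; split.
  by move=> k; rewrite /g; case: unpickle => [[i j]|];
    [case: (JP (ns_sub (e i) (e j))) | case: (JP ns_zero)].
move=> x y xe ye gxy; apply: ns_sub_eq0; apply: le_eps => eps e0; rewrite Rplus_0_l.
have [|i hi] := xe (eps / 4); first lra.
have [|j hj] := ye (eps / 4); first lra.
have := gxy (pickle (i, j)); rewrite /g pickleK.
have [Jd Jb Jn] := JP (ns_sub (e i) (e j)); move: Jd Jb Jn; set f := J _ => fd fb fn fxy.
have := dual_le (ns_sub (e i) x) fb; have := dual_le (ns_sub y (e j)) fb.
have := ns_dist_triangle (e i) x y; have := ns_dist_triangle (e j) (e i) y.
rewrite (ns_distC (e j) y) (ns_distC (e i) x) !(dualB fd) in fn *; lra.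
Qed.

End CountableHull.

Theorem weak_seq_compact (V : NormedSpace) (u : nat -> V) : reflexive V -> bounded_seq u ->
  exists h x, subseq_index h /\ weak_cv (fun n => u (h n)) x.
Proof.
move=> refl [M uM]; have [e [eu _ emid _]] := countable_hull u id.
have [g [gd gsep]] := separating_sequence e.
have ecl := @closureS_closed V e; have ecv := closureS_convex emid.
have ue n : closureS e (u n) by have [m <-] := eu n; apply: closureS_seq.
have [G [GU Gt]] := tails_ultra.
have limE (v : nat -> V) (x : V) : (forall n, closureS e (v n)) ->
    (forall f, in_dual f -> ultra_lim G (fun i => f (v i)) (f x)) -> closureS e x.
  move=> ve vx; apply: mazur => // f fd eps e0.
  by have [n /= hn] := filter_ex (vx f fd eps e0); exists (v n).
have [x xP] := weak_ultra_lim GU refl uM.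
(* Diagonal extraction: at stage [n] the first [n + 1] separating functionals are already within
   [/ INR n.+1] of their values at the ultralimit [x]. *)
have [h [hh hQ]] : exists h, subseq_index h /\
    forall n k, (k <= n)%N -> Rabs (g k (u (h n)) - g k x) < / INR n.+1.
  apply: (@subseq_exists (fun n i => forall k, (k <= n)%N ->
    Rabs (g k (u i) - g k x) < / INR n.+1)) => n N.
  have H m : G [set i | forall k, (k < m)%N -> Rabs (g k (u i) - g k x) < / INR n.+1]%classic.
    elim: m => [|m IH]; first by apply: filterS filterT.
    apply: filterS (filterI IH (xP _ (gd m) _ (inv_INR_gt0 n))) => i [/= h1 h2] k.
    by rewrite ltnS leq_eqVlt => /orP[/eqP->//|]; apply: h1.
  have T : G [set i | (N <= i)%N]%classic by apply: Gt; exists N.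
  by have [i [/= Ni h]] := filter_ex (filterI T (H n.+1)); exists i; split=> // k kn; apply: h.
exists h, x; split => // f fd eps e0; apply: contrapT => nh.
have [l [ll lP]] : exists l, subseq_index l /\
    forall n, eps <= Rabs (f (u (h (l n))) - f x).
  apply: (@subseq_exists (fun _ n => eps <= Rabs (f (u (h n)) - f x))) => _ N.
  apply: contrapT => nN; apply: nh; exists N => n Nn; apply: Rnot_le_lt => hn.
  by apply: nN; exists n; split=> //; apply/leP.
(* A subsequence staying away from [x] along [f] has its own ultralimit [x']. It lies in the same
   separable closed convex set and agrees with [x] on every [g k], so it equals [x], a
   contradiction. *)
have [x' x'P] := weak_ultra_lim GU refl (fun n => uM (h (l n))).
have xx' : x' = x.
  apply: gsep.
  - by apply: (limE (fun i => u (h (l i)))) => // n.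
  - by apply: (limE u).
  - move=> k; apply: (ultra_lim_unique GU (x'P _ (gd k))) => d d0.
    have [N hN] := inv_INR_lt d0; apply: Gt; exists (maxn N k) => n /=.
    rewrite geq_max => /andP[Nn kn]; have nl := subseq_index_ge n ll.
    apply: Rlt_trans (hQ (l n) k (leq_trans kn nl)) _.
    by apply: hN; apply: leq_trans nl.
have [i /= hi] := filter_ex (x'P f fd eps e0).
by have := lP i; rewrite xx' in hi; lra.
Qed.

#[local] Arguments INR : simpl never.

(** * A fixed point theorem on the simplex *)

HB.instance Definition _ := Monoid.isComLaw.Build R 0 Rplus
  (fun x y z => esym (Rplus_assoc x y z)) Rplus_comm Rplus_0_l.

Notation rsum F := (\big[Rplus/0]_i F i).

Section RealSums.
Variable I : finType.
Implicit Types F G : I -> R.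

Lemma rsum_le F G : (forall i, F i <= G i) -> rsum F <= rsum G.
Proof.
move=> h; elim/big_ind2: _ => // [|a b c d ? ?]; first exact: Rle_refl.
exact: Rplus_le_compat.
Qed.

Lemma rsum_ge0 F : (forall i, 0 <= F i) -> 0 <= rsum F.
Proof. by move=> h; elim/big_ind: _ => // *; lra. Qed.

Lemma rsumD F G : rsum (fun i => F i + G i) = rsum F + rsum G.
Proof. exact: big_split. Qed.

Lemma rsumZ r F : rsum (fun i => r * F i) = r * rsum F.
Proof.
by rewrite (big_morph (Rmult r) (fun a b => Rmult_plus_distr_l r a b) (Rmult_0_r r)).
Qed.

Lemma rsumB F G : rsum (fun i => F i - G i) = rsum F - rsum G.
Proof.
rewrite (_ : rsum F - rsum G = rsum F + -1 * rsum G); last ring.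
by rewrite -rsumZ -rsumD; apply: eq_bigr => i _; ring.
Qed.

Lemma rsum_ge_term F i : (forall j, 0 <= F j) -> F i <= rsum F.
Proof.
move=> h; rewrite (bigD1 i) //=.
have : 0 <= \big[Rplus/0]_(j | j != i) F j by elim/big_ind: _ => // *; lra.
lra.
Qed.

Lemma rsum_eq0 F : (forall i, 0 <= F i) -> rsum F <= 0 -> forall i, F i = 0.
Proof. by move=> h s i; have := rsum_ge_term i h; have := h i; lra. Qed.

Lemma rsum_const c : rsum (fun _ : I => c) = INR #|I| * c.
Proof.
rewrite big_const; elim: #|_| => [|n IH]; first by rewrite Rmult_0_l.
by rewrite iterS IH S_INR; ring.
Qed.

Lemma Rabs_rsum F : Rabs (rsum F) <= rsum (fun i => Rabs (F i)).
Proof.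
elim/big_ind2: _ => // [|a b c d h1 h2|*]; first by rewrite Rabs_R0; lra.
  by apply: Rle_trans (Rabs_triang _ _) _; lra.
exact: Rle_refl.
Qed.

Lemma INR_rsum (f : I -> nat) : INR (\sum_i f i) = rsum (fun i => INR (f i)).
Proof. by apply: (big_morph INR) => // m n; apply: plus_INR. Qed.

Lemma uniform_bound (P : I -> R -> Prop) :
  (forall i, exists L, 0 <= L /\ P i L) -> (forall i L L', L <= L' -> P i L -> P i L') ->
  exists L, 0 <= L /\ forall i, P i L.
Proof.
move=> /choice[L LP] Pmono; exists (rsum L); split.
  by apply: rsum_ge0 => i; have [] := LP i.
move=> i; have [_ h] := LP i; apply: Pmono h; apply: rsum_ge_term => j.
by have [] := LP j.
Qed.

End RealSums.

Lemma Rabs_le_inv a b : Rabs a <= b -> - b <= a <= b.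
Proof. by rewrite /Rabs; case: Rcase_abs => *; lra. Qed.

Lemma le_eps_scal a b c : 0 <= c -> (forall e, 0 < e -> a <= b + c * e) -> a <= b.
Proof.
move=> c0 h; apply: le_eps => e e0.
have d0 : 0 < e / (c + 1) by apply: Rdiv_lt_0_compat; lra.
have := h _ d0; rewrite (_ : c * _ = e - e / (c + 1)); last by field; lra.
lra.
Qed.

Section SimplexFixpoint.
Variable n : nat.
Implicit Types x y : 'I_n.+1 -> R.

Definition simplex x := (forall i, 0 <= x i) /\ rsum x = 1.

Definition dist1 x y := rsum (fun j => Rabs (x j - y j)).

Definition lipschitz (f : ('I_n.+1 -> R) -> R) :=
  exists L, 0 <= L /\ forall x y, Rabs (f x - f y) <= L * dist1 x y.

Lemma dist1_ge0 x y : 0 <= dist1 x y.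
Proof. by apply: rsum_ge0 => i; apply: Rabs_pos. Qed.

Lemma dist1_triangle y x z : dist1 x z <= dist1 x y + dist1 y z.
Proof.
rewrite /dist1 -rsumD; apply: rsum_le => i.
by rewrite (_ : x i - z i = x i - y i + (y i - z i)); [apply: Rabs_triang | ring].
Qed.

(* Brouwer's theorem for the self-map [w i / rsum w] of the simplex, without the division. *)
Theorem simplex_fixpoint (w : 'I_n.+1 -> ('I_n.+1 -> R) -> R) :
  (forall i x, 0 <= w i x) -> (forall i, lipschitz (w i)) ->
  exists x, simplex x /\ forall i, x i * rsum (fun j => w j x) = w i x.
Proof.
move=> w0 wL.
have [L [L0 wLip]] : exists L, 0 <= L /\ forall i x y, Rabs (w i x - w i y) <= L * dist1 x y.
  apply: (uniform_bound (P := fun i L => forall x y, Rabs (w i x - w i y) <= L * dist1 x y)) => //.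
  move=> i L L' LL' h x y; apply: Rle_trans (h x y) _.
  by apply: Rmult_le_compat_r => //; apply: dist1_ge0.
pose W x := rsum (fun j => w j x).
have W0 x : 0 <= W x by apply: rsum_ge0.
(* Both sides sum to [W x] over [i], so they cannot be strictly ordered the wrong way for every [i].
   Such an index is the label of a grid point. *)
have label x : rsum x = 1 -> exists i, x i * W x <= w i x.
  move=> sx; apply: contrapT => h.
  have h' i : w i x < x i * W x by apply: Rnot_le_lt => hi; apply: h; exists i.
  have /rsum_eq0 e : forall i, 0 <= x i * W x - w i x by move=> i; have := h' i; lra.
  have := h' ord0; have := e _ ord0; rewrite rsumB.
  rewrite (eq_bigr (fun i => W x * x i)); last by move=> i _; ring.
  by rewrite rsumZ sx -/(W x) => /(_ ltac:(lra)); lra.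
pose sc N (x : 'I_n.+1 -> nat) := fun i => INR (x i) / INR N.+1.
have scE N (x : 'I_n.+1 -> nat) : rsum (sc N x) = INR (\sum_i x i) / INR N.+1.
  rewrite INR_rsum /Rdiv Rmult_comm -rsumZ; apply: eq_bigr => i _; rewrite /sc; lra.
have N0 N : 0 < INR N.+1 by apply: lt_0_INR; apply/ltP.
have /choice[m mP] : forall N, exists m : 'I_n.+1 -> nat,
    [/\ (\sum_i m i <= N.+1)%N, (N.+1 <= \sum_i m i + n)%N &
    forall i, m i = 0%N \/ exists x : 'I_n.+1 -> nat, [/\ (\sum_j x j = N.+1)%N,
      forall j, (m j <= x j)%N & sc N x i * W (sc N x) <= w i (sc N x)]].
  move=> N; have /choice[c cP] : forall x : 'I_n.+1 -> nat, exists i,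
      (\sum_j x j = N.+1)%N -> sc N x i * W (sc N x) <= w i (sc N x).
    move=> x; have [e|h] := pselect (\sum_j x j = N.+1)%N; last by exists ord0.
    have [|i hi] := label (sc N x); last by exists i.
    by rewrite scE e; field; have := N0 N; lra.
  have [m [m1 m2 m3]] := scarf_grid N.+1 c; exists m; split=> // i.
  have [->|[x [h1 h2 h3]]] := m3 i; [by left | right; exists x; split=> //].
  by rewrite -h3; apply: cP.
have m01 N i : 0 <= sc N (m N) i <= 1.
  have [h _ _] := mP N; have : (m N i <= N.+1)%N.
    by apply: leq_trans h; rewrite (bigD1 i) //= leq_addr.
  move=> /leP/le_INR h'; split; first by apply: Rle_mult_inv_pos => //; apply: pos_INR.
  apply: (Rmult_le_reg_r (INR N.+1)) => //; rewrite /sc /Rdiv Rmult_assoc Rinv_l; first lra.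
  by have := N0 N; lra.
have [G [GU Gt]] := tails_ultra.
have /choice[l lP] : forall i, exists l, ultra_lim G (fun N => sc N (m N) i) l.
  move=> i; apply: (@ultra_lim_exists _ _ GU _ 1) => N; rewrite Rabs_right; have := m01 N i; lra.
have near d : 0 < d -> exists N, INR n / INR N.+1 < d /\ forall i, Rabs (sc N (m N) i - l i) < d.
  move=> d0; have [|N0' hN] := @inv_INR_lt (d / (INR n + 1)).
    by apply: Rdiv_lt_0_compat => //; have := pos_INR n; lra.
  have H (s : seq 'I_n.+1) : G [set N | forall i, i \in s -> Rabs (sc N (m N) i - l i) < d]%classic.
    elim: s => [|i s IH]; first by apply: filterS filterT.
    apply: filterS (filterI IH (lP i d d0)) => N [/= h1 h2] j.
    by rewrite inE => /orP[/eqP->//|]; apply: h1.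
  have [N [/= h1 h2]] := filter_ex (filterI (H (enum 'I_n.+1)) (Gt _ (ex_intro _ N0' (fun n h => h)))).
  exists N; split; last by move=> i; apply: h1; rewrite mem_enum.
  have n0 := pos_INR n; have := hN N h2; have := Rinv_0_lt_compat _ (N0 N).
  move=> i0 /(Rmult_lt_compat_r (INR n + 1) _ _ ltac:(lra)).
  by rewrite (_ : d / _ * _ = d); [rewrite /Rdiv; lra | field; lra].
have smN N : 1 - INR n / INR N.+1 <= rsum (sc N (m N)) <= 1.
  have [/leP/le_INR h1 /leP/le_INR h2 _] := mP N; rewrite plus_INR in h2; rewrite scE.
  have i0 := Rinv_0_lt_compat _ (N0 N); have e : INR N.+1 * / INR N.+1 = 1.
    by apply: Rinv_r; have := N0 N; lra.
  by rewrite /Rdiv; split; nra.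
have l0 i : 0 <= l i.
  apply: le_eps => e e0; have [N [_ /(_ i)/Rabs_def2]] := near e e0; have := m01 N i; lra.
have nn := pos_INR n.+1.
have rsum_ord c : rsum (fun _ : 'I_n.+1 => c) = INR n.+1 * c by rewrite rsum_const card_ord.
have dl d N : (forall i, Rabs (sc N (m N) i - l i) < d) -> dist1 (sc N (m N)) l <= INR n.+1 * d.
  move=> h; rewrite -rsum_ord; apply: rsum_le => i.
  exact/Rlt_le/h.
have sl : rsum l = 1.
  have : Rabs (rsum l - 1) <= 0.
    apply: (@le_eps_scal _ _ (INR n.+1 + 1)); first lra.
    move=> d d0; have [N [h1 h2]] := near d d0; have h3 := smN N; have := dl d N h2.
    have := Rabs_rsum (fun i => sc N (m N) i - l i); rewrite rsumB -/(dist1 _ _).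
    move=> h4 h5; have /Rabs_le_inv h6 := Rle_trans _ _ _ h4 h5.
    by apply: Rabs_le; lra.
  by move=> /Rabs_le_inv; lra.
exists l; split=> //.
(* Either the [i]-th minimum vanishes for an arbitrarily late grid, making [l i] small, or a grid
   point labelled [i] is close to [l]. In the latter case the label inequality passes to [l] by
   Lipschitz continuity, [C] collecting the error coefficients. *)
have key i : l i * W l <= w i l.
  pose C := W l * (INR n.+1 + 1) + (1 + INR n.+1) * L * (INR n.+1 + 1).
  have Wl := W0 l.
  apply: (@le_eps_scal _ _ C); first by rewrite /C; apply: Rplus_le_le_0_compat; nra.
  move=> d d0; have [N [h1 h2]] := near d d0; have [_ _ /(_ i)] := mP N.
  case=> [mi|[x [sx mx hx]]].
    have : l i <= d.
      by have := h2 i; rewrite /sc mi /Rdiv (_ : INR 0 = 0) // Rmult_0_l => /Rabs_def2; lra.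
    move=> lid; have := w0 i l; have D0 : 0 <= (1 + INR n.+1) * L * (INR n.+1 + 1) by nra.
    have := Rmult_le_compat_r _ _ _ Wl lid; have := Rmult_le_pos _ _ D0 (Rlt_le _ _ d0).
    have := Rmult_le_pos _ _ (Rmult_le_pos _ _ Wl nn) (Rlt_le _ _ d0).
    by rewrite /C; lra.
  set y := sc N x in hx; have sy : rsum y = 1.
    by rewrite scE sx; field; have := N0 N; lra.
  have ym : dist1 y (sc N (m N)) <= d.
    rewrite /dist1 (eq_bigr (fun j => y j - sc N (m N) j)); last first.
      move=> j _; apply: Rabs_right; have /leP/le_INR := mx j.
      have := Rinv_0_lt_compat _ (N0 N); rewrite /y /sc /Rdiv; nra.
    by rewrite rsumB sy; have := smN N; lra.
  have y1 : 0 <= y i <= 1.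
    have y0 j : 0 <= y j by apply: Rle_mult_inv_pos => //; apply: pos_INR.
    by split=> //; rewrite -sy; apply: rsum_ge_term.
  pose eta := (INR n.+1 + 1) * d.
  have yl : dist1 y l <= eta.
    by apply: Rle_trans (dist1_triangle (sc N (m N)) _ _) _; have := dl d N h2; rewrite /eta; lra.
  have wy j : Rabs (w j y - w j l) <= L * eta.
    by apply: Rle_trans (wLip _ _ _) _; apply: Rmult_le_compat_l.
  have Wy : Rabs (W y - W l) <= INR n.+1 * (L * eta).
    rewrite /W -rsumB; apply: Rle_trans (Rabs_rsum _) _.
    by rewrite -rsum_ord; apply: rsum_le.
  have yi : Rabs (y i - l i) <= eta.
    by apply: Rle_trans yl; apply: (rsum_ge_term (F := fun j => Rabs (y j - l j))) => j; apply: Rabs_pos.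
  move/Rabs_le_inv: yi => yi; move/Rabs_le_inv: Wy => Wy; have /Rabs_le_inv wi := wy i.
  have e1 : l i * W l - y i * W y <= eta * W l + INR n.+1 * (L * eta).
    have -> : l i * W l - y i * W y = (l i - y i) * W l + y i * (W l - W y) by ring.
    apply: Rplus_le_compat; first by apply: Rmult_le_compat_r; lra.
    have : 0 <= INR n.+1 * (L * eta) by lra.
    by nra.
  have -> : C * d = eta * W l + INR n.+1 * (L * eta) + L * eta by rewrite /C /eta; ring.
  lra.
(* The two sides of [key] have the same sum [W l], so all the inequalities are equalities. *)
move=> i; have /rsum_eq0 e : forall i, 0 <= w i l - l i * W l by move=> j; have := key j; lra.
have lW : rsum (fun i => l i * W l) = W l.
  by rewrite (eq_bigr (fun i => W l * l i)) ?rsumZ ?sl ?Rmult_1_r // => j _; ring.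
by have := e _ i; rewrite rsumB lW -/(W l) => /(_ ltac:(lra)); lra.
Qed.

End SimplexFixpoint.

(** * Monotone variational inequalities *)

Section ConvexCombinations.
Variables (V : NormedSpace) (n : nat).

Definition vcomb (l : 'I_n.+1 -> R) (s : 'I_n.+1 -> V) : V :=
  \big[@ns_add V/ns_zero]_i ns_scal (l i) (s i).

Lemma dual_vcomb (f : V -> R) l s : in_dual f -> f (vcomb l s) = rsum (fun i => l i * f (s i)).
Proof.
move=> fd; rewrite /vcomb (big_morph f (dualD fd) (dual0 fd)).
by apply: eq_bigr => i _; rewrite dualZ.
Qed.

(** Carrying a number along with the point gives convex membership and Jensen's inequality from one
    induction. *)
Lemma vcomb_ind (P : V -> R -> Prop) (l : 'I_n.+1 -> R) (s : 'I_n.+1 -> V) (a : 'I_n.+1 -> R) :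
  (forall x y a b t, P x a -> P y b -> 0 <= t <= 1 ->
     P (ns_add (ns_scal t x) (ns_scal (1 - t) y)) (t * a + (1 - t) * b)) ->
  simplex l -> (forall i, P (s i) (a i)) -> P (vcomb l s) (rsum (fun i => l i * a i)).
Proof.
move=> Pcvx [l0 l1] Ps; rewrite /vcomb.
(* Partial sums are normalized by their weight; the first alternative covers partial weight zero,
   where this is impossible. *)
have key (r : seq 'I_n.+1) : let t := \big[Rplus/0]_(i <- r) l i in
    let x := \big[@ns_add V/ns_zero]_(i <- r) ns_scal (l i) (s i) in
    let b := \big[Rplus/0]_(i <- r) (l i * a i) in
    [/\ t = 0, x = ns_zero & b = 0] \/ 0 < t /\ P (ns_scal (/ t) x) (/ t * b).
  elim: r => [|i r] /=; first by rewrite !big_nil; left.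
  rewrite !big_cons; set t := \big[_/_]_(j <- r) l j; set b := \big[_/_]_(j <- r) (l j * a j).
  set x := bigop _ r _.
  have li := l0 i; have [li0|li0] := Req_dec (l i) 0.
    by rewrite li0 ns_scal0 ns_add0l !Rmult_0_l !Rplus_0_l.
  case=> [[-> -> ->]|[t0 Pt]]; right.
    rewrite ns_add_zero !Rplus_0_r; split; first lra.
    rewrite ns_scal_assoc -Rmult_assoc Rinv_l // ns_scal_one Rmult_1_l; exact: Ps.
  split; first lra.
  have t01 : 0 <= l i / (l i + t) <= 1.
    have h1 := Rdiv_lt_0_compat (l i) (l i + t) ltac:(lra) ltac:(lra).
    have h2 := Rdiv_lt_0_compat t (l i + t) ltac:(lra) ltac:(lra).
    by have : l i / (l i + t) + t / (l i + t) = 1; [field; lra | lra].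
  have := Pcvx _ _ _ _ _ (Ps i) Pt t01.
  rewrite (_ : ns_add _ _ = ns_scal (/ (l i + t)) (ns_add (ns_scal (l i) (s i)) x)); last by vec.
  by rewrite (_ : _ + (1 - _) * _ = / (l i + t) * (l i * a i + b)) //; field; lra.
have := key (index_enum _); rewrite /= l1; case=> [[]|[_]]; first lra.
by rewrite Rinv_1 ns_scal_one Rmult_1_l.
Qed.

Lemma vcomb_convex (S : V -> Prop) l s : convexS S -> simplex l -> (forall i, S (s i)) -> S (vcomb l s).
Proof.
move=> Scv sl Ss; apply: (@vcomb_ind (fun x _ => S x) l s (fun=> 0)) => // x y _ _ t Sx Sy t01.
exact: Scv.
Qed.

End ConvexCombinations.

Section LipschitzSimplex.
Variable n : nat.

Lemma lipschitz_linear (a : 'I_n.+1 -> R) : lipschitz (fun l : 'I_n.+1 -> R => rsum (fun j => l j * a j)).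
Proof.
exists (rsum (fun j => Rabs (a j))); split; first by apply: rsum_ge0 => j; apply: Rabs_pos.
move=> x y; rewrite -rsumB /dist1; apply: Rle_trans (Rabs_rsum _) _.
rewrite -rsumZ; apply: rsum_le => j.
rewrite (_ : _ - _ = a j * (x j - y j)); last ring.
rewrite Rabs_mult; apply: Rmult_le_compat_r; first exact: Rabs_pos.
by apply: (rsum_ge_term (F := fun j => Rabs (a j))) => k; apply: Rabs_pos.
Qed.

Lemma lipschitz_max0 (f : ('I_n.+1 -> R) -> R) : lipschitz f -> lipschitz (fun l => Rmax 0 (f l)).
Proof.
move=> [L [L0 h]]; exists L; split=> // x y; apply: Rle_trans (h x y).
by rewrite /Rmax /Rabs; repeat case: Rle_dec => ?; repeat case: Rcase_abs => ?; lra.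
Qed.

End LipschitzSimplex.

Definition convex_on (V : NormedSpace) (S : V -> Prop) (psi : V -> R) :=
  forall x y t, S x -> S y -> 0 <= t <= 1 ->
    psi (ns_add (ns_scal t x) (ns_scal (1 - t) y)) <= t * psi x + (1 - t) * psi y.

Definition continuous_on (V : NormedSpace) (S : V -> Prop) (psi : V -> R) :=
  forall (u : nat -> V) x, (forall n, S (u n)) -> S x -> ns_cv u x -> Un_cv (fun n => psi (u n)) (psi x).

Section VariationalInequality.
Variables (V : NormedSpace) (F : V -> V -> R) (psi : V -> R).
Hypothesis (Vrefl : reflexive V).
Hypothesis F_dual : forall u, in_dual (F u).
Hypothesis F_mono : forall u v, F u (ns_sub u v) - F v (ns_sub u v) >= 0.
Hypothesis F_cont : forall u eps, eps > 0 -> exists delta, delta > 0 /\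
  forall v, ns_norm (ns_sub v u) < delta -> functional_bounded_by (fun w => F v w - F u w) eps.

Definition vi_sol (K : V -> Prop) u :=
  K u /\ forall v, K v -> 0 <= F u (ns_sub v u) + psi v - psi u.

Definition minty_sol (K : V -> Prop) u :=
  K u /\ forall v, K v -> 0 <= F v (ns_sub v u) + psi v - psi u.

Lemma segment_eq (u v : V) t :
  ns_add (ns_scal t v) (ns_scal (1 - t) u) = ns_add u (ns_scal t (ns_sub v u)).
Proof. by vec. Qed.

(** One direction is monotonicity. For the other, Minty's inequality is tested at [u + t (v - u)],
    convexity of [psi] lets one divide by [t], and continuity of [F] at [u] replaces [F w] by [F u]
    for small [t]. *)
Lemma vi_minty K u : convexS K -> convex_on K psi -> vi_sol K u <-> minty_sol K u.
Proof.
move=> Kcv psicv; split=> -[Ku h]; split=> // v Kv; first by have := h v Kv; have := F_mono v u; lra.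
have d0 := ns_norm_ge0 (ns_sub v u); set d := ns_norm _ in d0.
apply: (@le_eps_scal _ _ d) => // e e0; have [dl [dl0 hd]] := F_cont u e0.
pose t := Rmin 1 (dl / 2 / (d + 1)).
have q0 : 0 < dl / 2 / (d + 1) by apply: Rdiv_lt_0_compat; lra.
have t0 : 0 < t by apply: Rmin_pos; lra.
have t1 : t <= 1 by apply: Rmin_l.
have td : t * d < dl.
  have h1 : t * (d + 1) <= dl / 2 / (d + 1) * (d + 1).
    by apply: Rmult_le_compat_r; [lra | apply: Rmin_r].
  rewrite (_ : dl / 2 / _ * _ = dl / 2) in h1; last by field; lra.
  by nra.
have Kw := Kcv _ _ t Kv Ku ltac:(lra); have := h _ Kw.
have := psicv _ _ t Kv Ku ltac:(lra); rewrite segment_eq; set w := ns_add u _.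
have -> : ns_sub w u = ns_scal t (ns_sub v u) by rewrite /w; vec.
rewrite dualZ // => h1 h2.
have := hd w; rewrite (_ : ns_sub w u = ns_scal t (ns_sub v u)); last by rewrite /w; vec.
rewrite ns_scal_pos -/d; last lra.
move=> /(_ td)/(_ (ns_sub v u))/Rabs_le_inv; rewrite -/d => h3.
suff : 0 <= t * (F u (ns_sub v u) + d * e + psi v - psi u) by nra.
by nra.
Qed.

(** For fixed [v], Minty's inequality is a sublevel condition on a convex function of [u]. Hence it
    survives weak limits, unlike the original inequality. *)
Lemma minty_sublevel_closed_convex K v c : closedS K -> convexS K ->
  convex_on K psi -> continuous_on K psi ->
  let S u := K u /\ psi u + F v u <= c in closedS S /\ convexS S.
Proof.
move=> Kcl Kcv psicv psict S; split.
  move=> u x Su ux; have Kx : K x by apply: Kcl ux => n; case: (Su n).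
  split=> //; apply: le_eps => e e0.
  have Ku n : K (u n) by case: (Su n).
  have [|N1 h1] := psict u x Ku Kx ux (e / 2); first lra.
  have [|N2 h2] := ns_cv_weak ux (F_dual v) (eps := e / 2); first lra.
  have := h1 (maxn N1 N2) (leP (leq_maxl _ _)); have := h2 (maxn N1 N2) (leP (leq_maxr _ _)).
  have [_] := Su (maxn N1 N2); rewrite /R_dist => h /Rabs_def2 ? /Rabs_def2 ?; lra.
move=> x y t [Kx hx] [Ky hy] t01; split; first exact: Kcv.
by have := psicv x y t Kx Ky t01; rewrite (dualD (F_dual v)) !(dualZ (F_dual v)); nra.
Qed.

(* [g i l] is the excess of the [i]-th inequality at [u = vcomb l v].  By
   monotonicity the [l]-average of the excesses is at most
   [- rsum (fun i => l i * F u (ns_sub (v i) u)) = 0], whereas at a fixed point with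
   a positive excess it would be positive. *)
Lemma minty_finite K n (v : 'I_n.+1 -> V) : convexS K -> convex_on K psi -> (forall i, K (v i)) ->
  exists u, K u /\ forall i, 0 <= F (v i) (ns_sub (v i) u) + psi (v i) - psi u.
Proof.
move=> Kcv psicv Kv.
pose a i j := psi (v j) - psi (v i) - F (v i) (ns_sub (v i) (v j)).
pose g i (l : 'I_n.+1 -> R) := rsum (fun j => l j * a i j).
have [||l [sl hl]] := @simplex_fixpoint n (fun i l => Rmax 0 (g i l)).
- by move=> i x; apply: Rmax_l.
- by move=> i; apply/lipschitz_max0/lipschitz_linear.
pose u := vcomb l v; have [l0 l1] := sl.
have gE i : g i l = rsum (fun j => l j * psi (v j)) - psi (v i) - F (v i) (ns_sub (v i) u).
  rewrite dualB // /u dual_vcomb // /g.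
  rewrite -[psi (v i) in RHS]Rmult_1_r -[F (v i) (v i) in RHS]Rmult_1_r -l1 -!rsumZ -!rsumB.
  by apply: eq_bigr => j _; rewrite /a dualB //; ring.
have Jensen : psi u <= rsum (fun j => l j * psi (v j)).
  have [] // := @vcomb_ind V n (fun x b => K x /\ psi x <= b) l v (fun j => psi (v j)) _ sl _.
    move=> x y b c t [Kx hx] [Ky hy] t01; split; first exact: Kcv.
    by have := psicv x y t Kx Ky t01; nra.
  by move=> i; split=> //; lra.
exists u; split; first exact: vcomb_convex.
suff gle i : g i l <= 0 by move=> i; have := gle i; rewrite gE; lra.
apply: Rnot_lt_le => gi; pose W := rsum (fun j => Rmax 0 (g j l)).
have {}hl j : l j * W = Rmax 0 (g j l) := hl j.
have W0 : 0 < W.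
  apply: Rlt_le_trans gi _; apply: Rle_trans (Rmax_r 0 _) _.
  by apply: (rsum_ge_term (F := fun j => Rmax 0 (g j l))) => j; apply: Rmax_l.
(* As [W > 0], a nonpositive excess forces [l j = 0]; otherwise [g j l = W * l j]. The averaged
   excess is thus [W] times a sum of squares. *)
have lg j : l j * g j l = W * (l j * l j).
  have := hl j; have := l0 j; rewrite /Rmax; case: Rle_dec => h lj e; first by nra.
  by have -> : l j = 0; [nra | ring].
have : rsum (fun j => l j * g j l) <= 0.
  have -> : rsum (fun j => l j * g j l) = - rsum (fun j => l j * F (v j) (ns_sub (v j) u)).
    have -> : forall b, - b = rsum (fun j => l j * psi (v j)) * rsum l - rsum (fun j => l j * psi (v j)) - b.
      by move=> b; rewrite l1; ring.
    by rewrite -rsumZ -!rsumB; apply: eq_bigr => j _; rewrite gE; ring.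
  have Fu0 : rsum (fun j => l j * F u (ns_sub (v j) u)) = 0.
    transitivity (rsum (fun j => l j * F u (v j)) - F u u * rsum l).
      by rewrite -rsumZ -rsumB; apply: eq_bigr => j _; rewrite (dualB (F_dual u)); ring.
    by rewrite -(dual_vcomb l v (F_dual u)) l1 -/u; ring.
  have : rsum (fun j => l j * F u (ns_sub (v j) u)) <= rsum (fun j => l j * F (v j) (ns_sub (v j) u)).
    apply: rsum_le => j; apply: Rmult_le_compat_l => //.
    by have := F_mono (v j) u; lra.
  by rewrite Fu0; lra.
rewrite (eq_bigr _ (fun j _ => lg j)) rsumZ => h.
have h' : rsum (fun j => l j * l j) <= 0 by nra.
have lz j : l j = 0.
  by have := rsum_eq0 (fun j => Rle_0_sqr (l j)) h' j; apply: Rsqr_0_uniq.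
have : rsum l = 0 by apply: big1 => j _; rewrite lz.
by rewrite l1; lra.
Qed.

(** Compactness over finite lists of test points: [u l] satisfies Minty's inequality for all points
    of [l], and a weak limit along an ultrafilter refining the inclusion of lists satisfies all of
    them. *)
Lemma vi_bounded K : ne_set K -> closedS K -> convexS K -> boundedS K ->
  convex_on K psi -> continuous_on K psi -> exists u, vi_sol K u.
Proof.
move=> [v0 Kv0] Kcl Kcv [M KM] psicv psict.
have /choice[u uP] : forall l : seq V, exists u, K u /\ ((forall v, List.In v l -> K v) ->
    forall v, List.In v l -> 0 <= F v (ns_sub v u) + psi v - psi u).
  move=> l; have [Kl|nKl] := pselect (forall v, List.In v l -> K v); last by exists v0.
  have nthE k : (k < size l)%N -> List.In (nth v0 l k) l.
    elim: l k {Kl} => [|x l IH] [|k] //= kl; [by left | right; exact: IH].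
  (* There is one index more than list entries, so that the empty list is covered; the spare index
     falls on the default [v0], which is in [K]. *)
  have [i|u [Ku hu]] := @minty_finite K (size l) (fun i => nth v0 l i) Kcv psicv.
    have [il|il] := ltnP i (size l); first by apply/Kl/nthE.
    by rewrite nth_default.
  exists u; split=> // _ v vl; have [k [kl ->]] : exists k, (k < size l)%N /\ v = nth v0 l k.
    elim: l vl {Kl nthE hu u Ku} => //= x l IH [->|/IH[k [kl e]]]; first by exists 0%N.
    by exists k.+1.
  by have := hu (Ordinal (ltnW kl : (k < (size l).+1)%N)).
pose B : set (set (seq V)) := fun P => exists l0, (forall v, List.In v l0 -> K v) /\
  forall l, (forall v, List.In v l -> K v) -> (forall v, List.In v l0 -> List.In v l) -> P l.
have [G [GU BG]] : exists G, UltraFilter G /\ (B `<=` G)%classic.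
  apply: ultraFilterLemma; apply: Build_ProperFilter_ex.
    by move=> P [l0 [Kl0 h]]; exists l0; apply: h.
  split; first by exists [::].
  - move=> P Q [l1 [K1 h1]] [l2 [K2 h2]]; exists (l1 ++ l2); split.
      by move=> v /List.in_app_iff[]; [apply: K1 | apply: K2].
    move=> l Kl ll; split; [apply: h1 | apply: h2] => // v vl; apply: ll;
      apply/List.in_app_iff; by [left | right].
  - by move=> P Q PQ [l [Kl h]]; exists l; split=> // l' Kl' ll'; apply: PQ; apply: h.
have [x xP] := weak_ultra_lim GU Vrefl (fun l => KM _ (proj1 (uP l))).
have xS v : K v -> K x /\ psi x + F v x <= F v v + psi v.
  move=> Kv; have [Scl Scv] := minty_sublevel_closed_convex v (F v v + psi v) Kcl Kcv psicv psict.
  apply: (mazur Scl Scv) => f fd e e0.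
  have Gv : G [set l | (forall w, List.In w l -> K w) /\ List.In v l]%classic.
    apply: BG; exists [:: v]; split=> [w /= [<-|]//|l Kl vl]; split=> //.
    by apply: vl; left.
  have [l [/= [Kl vl] h]] := filter_ex (filterI Gv (xP f fd e e0)).
  exists (u l); split=> //; have [Ku hu] := uP l; split=> //.
  by have := hu Kl v vl; rewrite dualB //; lra.
have Kx : K x by have [] := xS v0 Kv0.
exists x; apply/vi_minty => //; split=> // v Kv; have [_] := xS v Kv.
by rewrite dualB //; lra.
Qed.

Lemma vi_coercive K v0 rho : K v0 -> closedS K -> convexS K ->
  convex_on K psi -> continuous_on K psi ->
  (forall u, K u -> F u (ns_sub u v0) + psi u - psi v0 <= 0 -> ns_norm u <= rho) ->
  exists u, vi_sol K u /\ ns_norm u <= rho.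
Proof.
move=> Kv0 Kcl Kcv psicv psict Kco.
(* The ball contains [v0], so coercivity applies to the truncated solution, and it leaves room 1
   beyond [rho]. A step of length below 1 from that solution towards any [v] in [K] is therefore
   admissible. *)
pose r := Rmax rho (ns_norm v0) + 1; pose Kr v := K v /\ ns_norm v <= r.
have rr : rho + 1 <= r by have := Rmax_l rho (ns_norm v0); rewrite /r; lra.
have r0 : ns_norm v0 <= r by have := Rmax_r rho (ns_norm v0); rewrite /r; lra.
have Krcv : convexS Kr.
  move=> x y t [Kx hx] [Ky hy] t01; split; first exact: Kcv.
  by apply: Rle_trans (ns_norm_triangle _ _ _) _; rewrite !ns_scal_pos; nra.
have [||||||u [[Ku ur] hu]] := @vi_bounded Kr.
- by exists v0.
- move=> w x Kw wx; split; first by apply: Kcl wx => n; case: (Kw n).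
  apply: le_eps => e e0; have [N hN] := wx e e0; have := hN N (le_n _).
  have [_] := Kw N; have := ns_norm_le_dist x (w N); rewrite ns_distC; lra.
- exact: Krcv.
- by exists r => v [].
- by move=> x y t [Kx _] [Ky _]; apply: psicv.
- by move=> w x Kw [Kx _]; apply: psict => // n; case: (Kw n).
have urho : ns_norm u <= rho.
  apply: Kco => //; have := hu v0 (conj Kv0 r0).
  rewrite (_ : ns_sub v0 u = ns_opp (ns_sub u v0)); last by vec.
  by rewrite dualN //; lra.
exists u; split=> //; split=> // v Kv; pose d := ns_norm (ns_sub v u).
have d0 : 0 <= d by apply: ns_norm_ge0.
pose t := / (d + 1); have t0 : 0 < t by apply: Rinv_0_lt_compat; lra.
have td : t * (d + 1) = 1 by apply: Rinv_l; lra.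
have t1 : t <= 1 by nra.
have Kw : Kr (ns_add (ns_scal t v) (ns_scal (1 - t) u)).
  split; first by apply: Kcv => //; lra.
  rewrite segment_eq; apply: Rle_trans (ns_norm_triangle _ _ _) _.
  by rewrite ns_scal_pos -/d; nra.
have := hu _ Kw; have := psicv _ _ t Kv Ku ltac:(lra); rewrite segment_eq.
rewrite (_ : ns_sub (ns_add u _) u = ns_scal t (ns_sub v u)); last by vec.
rewrite dualZ // => h1 h2; suff : 0 <= t * (F u (ns_sub v u) + psi v - psi u) by nra.
by nra.
Qed.

End VariationalInequality.

(** * Kluge's fixed point theorem *)

Section PartialSeminorms.
Variables (V : NormedSpace) (g : nat -> V -> R).
Hypothesis g_dual : forall k, in_dual (g k).

Definition gdist n x y := rsum (fun k : 'I_n => Rabs (g k x - g k y)).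

Lemma gdist_triangle n y x z : gdist n x z <= gdist n x y + gdist n y z.
Proof.
rewrite /gdist -rsumD; apply: rsum_le => k.
by rewrite (_ : g k x - g k z = g k x - g k y + (g k y - g k z)); [apply: Rabs_triang | ring].
Qed.

Lemma gdistC n x y : gdist n x y = gdist n y x.
Proof. by apply: eq_bigr => k _; rewrite Rabs_minus_sym. Qed.

Lemma gdist_ge k n x y : (k < n)%N -> Rabs (g k x - g k y) <= gdist n x y.
Proof.
move=> kn; apply: (rsum_ge_term (F := fun k : 'I_n => Rabs (g k x - g k y)) (Ordinal kn)) => j.
exact: Rabs_pos.
Qed.

Lemma gdist_weak_cv n (u : nat -> V) x e : weak_cv u x -> 0 < e ->
  exists N, forall j, (N <= j)%N -> gdist n (u j) x < e.
Proof.
move=> ux; elim: n e => [|n IH] e e0; first by exists 0%N => j _; rewrite /gdist big_ord0.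
have [|N hN] := IH (e / 2); first lra.
have [|N' hN'] := ux _ (g_dual n) (e / 2); first lra.
exists (maxn N N') => j; rewrite geq_max => /andP[jN /leP jN'].
have := hN j jN; have := hN' j jN'; rewrite /R_dist /gdist big_ord_recr /=; lra.
Qed.

(** Otherwise some [x N] stays [eps]-away from [e 0], ..., [e N] for each [N]. A weak limit of a
    subsequence lies in the closure, hence is close to some [e i], and so are late terms. *)
Lemma finite_net (e : nat -> V) n eps : reflexive V -> closedS (closureS e) -> convexS (closureS e) ->
  boundedS (closureS e) -> 0 < eps ->
  exists N, forall x, closureS e x -> exists i : 'I_N.+1, gdist n x (e i) < eps.
Proof.
move=> refl ecl ecv [M eM] e0; apply: contrapT => nh.
have /choice[x xP] : forall N, exists x, closureS e x /\ forall i : 'I_N.+1, eps <= gdist n x (e i).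
  move=> N; apply: contrapT => nx; apply: nh; exists N => x ex; apply: contrapT => ni.
  by apply: nx; exists x; split=> // i; apply: Rnot_lt_le => h; apply: ni; exists i.
have [|h [l [hh xl]]] := weak_seq_compact refl (u := x); first by exists M => k; apply: eM; case: (xP k).
have el : closureS e l by apply: (weak_cv_closed ecl ecv _ xl) => k; case: (xP (h k)).
have [i hi] : exists i, gdist n l (e i) < eps / 2.
  have /choice[j jP] := fun k => el _ (inv_INR_gt0 k).
  have jcv : ns_cv (fun k => e (j k)) l.
    move=> d d0; have [N hN] := inv_INR_lt d0; exists N => k /leP Nk.
    by rewrite ns_distC; apply: Rlt_trans (jP k) (hN k Nk).
  have [|N hN] := @gdist_weak_cv n _ _ (eps / 2) (ns_cv_weak jcv); first lra.
  by exists (j N); rewrite gdistC; apply: hN.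
have [|N hN] := @gdist_weak_cv n _ _ (eps / 2) xl; first lra.
pose k := maxn N i; have [_ hk] := xP (h k).
have ik : (i < (h k).+1)%N by rewrite ltnS; apply: leq_trans (subseq_index_ge k hh); apply: leq_maxr.
have := hk (Ordinal ik); have /= := gdist_triangle n l (x (h k)) (e i).
by have := hN k (leq_maxl _ _); lra.
Qed.

End PartialSeminorms.

Section Kluge.
Variables (V : NormedSpace) (D : V -> Prop) (Sel : V -> V -> Prop).
Hypothesis Vrefl : reflexive V.
Hypotheses (D_ne : ne_set D) (D_cl : closedS D) (D_cv : convexS D) (D_bd : boundedS D).
Hypothesis Sel_ne : forall w, D w -> exists u, D u /\ Sel w u.
Hypothesis Sel_cv : forall w, D w -> convexS (fun u => D u /\ Sel w u).
Hypothesis Sel_graph : forall (w u : nat -> V) w' u', (forall n, D (w n)) -> (forall n, D (u n)) ->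
  (forall n, Sel (w n) (u n)) -> weak_cv w w' -> weak_cv u u' -> Sel w' u'.

Lemma Sel_closed w : D w -> closedS (fun u => D u /\ Sel w u).
Proof.
move=> Dw u x uS ux; have uD n : D (u n) by case: (uS n).
split; first exact: D_cl ux.
apply: (Sel_graph (w := fun=> w) (u := u)) => //; first by move=> n; case: (uS n).
  by move=> f fd e e0; exists 0%N => *; rewrite /R_dist Rminus_diag Rabs_R0.
exact: ns_cv_weak.
Qed.

(* Inside a separable weakly closed set that is invariant under a selection [s]
   of [Sel], the weak topology is controlled by a sequence of functionals [g k].  For each [n],
   [simplex_fixpoint] yields a convex combination [x n] of values [s (e i)] whose
   base points [e i] are close to [x n] for [g 0], ..., [g (n-1)]; a weak
   limit of the [x n] is a fixed point. *)
Theorem kluge : exists w, D w /\ Sel w w.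
Proof.
have /choice[s sP] : forall w, exists u, D w -> D u /\ Sel w u.
  move=> w; have [Dw|nDw] := pselect (D w); last by exists w.
  by have [u hu] := Sel_ne Dw; exists u.
have [d0 Dd0] := D_ne.
have [e [ed es emid eind]] := countable_hull (fun=> d0) s.
have eD n : D (e n).
  apply: eind n => // [x Dx|x y Dx Dy]; first by case: (sP x Dx).
  have := @D_cv x y (/2) Dx Dy; rewrite (_ : 1 - / 2 = / 2); last lra.
  by apply; lra.
have [g [gd gsep]] := separating_sequence e.
have ecl := @closureS_closed V e; have ecv := closureS_convex emid.
have clD x : closureS e x -> D x.
  move=> ex; have /choice[j jP] := fun k => ex _ (inv_INR_gt0 k).
  apply: (D_cl (u := fun k => e (j k))) => // dl dl0; have [N hN] := inv_INR_lt dl0.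
  exists N => k /leP Nk; rewrite ns_distC; exact: Rlt_trans (jP k) (hN k Nk).
have [M DM] := D_bd.
have ebd : boundedS (closureS e) by exists M => x /clD; apply: DM.
have step n : exists x, closureS e x /\ exists N (l : 'I_N.+1 -> R),
    [/\ simplex l, x = vcomb l (fun i => s (e i)) &
      forall i, 0 < l i -> gdist g n x (e i) < / INR n.+1].
  have eps0 := inv_INR_gt0 n; set eps := / _ in eps0 *.
  have [N hN] := finite_net gd n Vrefl ecl ecv ebd eps0.
  pose x l := vcomb l (fun i : 'I_N.+1 => s (e i)).
  (* The weights are bumps around the net points, as in a partition of unity. They do not vanish
     together at [x l], since some net point is near, so at the fixed point only near base points
     have positive weight. *)
  have [||l [sl hl]] := @simplex_fixpoint N (fun i l => Rmax 0 (eps - gdist g n (x l) (e i))).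
  - by move=> i l; apply: Rmax_l.
  - move=> i; apply: lipschitz_max0.
    have [L [L0 hL]] : exists L, 0 <= L /\ forall (k : 'I_n) a b,
        Rabs (g k (x a) - g k (x b)) <= L * dist1 a b.
      apply: (uniform_bound (P := fun (k : 'I_n) L => forall a b,
        Rabs (g k (x a) - g k (x b)) <= L * dist1 a b)) => [k|k L L' LL' hL a b].
        have [L [L0 hL]] := lipschitz_linear (fun j : 'I_N.+1 => g k (s (e j))).
        by exists L; split=> // a b; rewrite /x !(dual_vcomb _ _ (gd k)).
      apply: Rle_trans (hL a b) _; apply: Rmult_le_compat_r => //; exact: dist1_ge0.
    exists (INR n * L); split; first by have := pos_INR n; nra.
    move=> a b; apply: Rle_trans (_ : gdist g n (x a) (x b) <= _).
      have := gdist_triangle g n (x b) (x a) (e i); have := gdist_triangle g n (x a) (x b) (e i).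
      by rewrite (gdistC g n (x b) (x a)) => *; apply: Rabs_le; lra.
    rewrite Rmult_assoc -[n in INR n]card_ord -rsum_const; apply: rsum_le => k; exact: hL.
  have ex : closureS e (x l).
    by apply: vcomb_convex => // i; have [m <-] := es i; apply: closureS_seq.
  exists (x l); split=> //; exists N, l; split=> // i li.
  have [j hj] := hN _ ex; have := hl i.
  have W0 : 0 < rsum (fun j : 'I_N.+1 => Rmax 0 (eps - gdist g n (x l) (e j))).
    apply: Rlt_le_trans (rsum_ge_term j _) => [|k]; last exact: Rmax_l.
    by apply: Rlt_le_trans (Rmax_r _ _); lra.
  have := Rmult_lt_0_compat _ _ li W0 => + hW; rewrite hW /Rmax.
  by case: Rle_dec => _; lra.
have /choice[x xP] := step.
have [|h [y [hh xy]]] := weak_seq_compact Vrefl (u := x).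
  by exists M => n; apply/DM/clD; case: (xP n).
have ey : closureS e y by apply: (weak_cv_closed ecl ecv _ xy) => n; case: (xP (h n)).
have Dy := clD _ ey; exists y; split=> //; apply: contrapT => nS.
have [f [d [fd d0' fS]]] : exists f d, [/\ in_dual f, 0 < d &
    forall u, D u /\ Sel y u -> f u + d <= f y].
  apply: convex_dist_sep; [|exact: Sel_closed|exact: Sel_cv|by case].
  by have [u hu] := Sel_ne Dy; exists u.
(* Otherwise points [z] near [x (h n)] for more and more functionals would have values [s z] on the
   wrong side of the gap. The [z] converge weakly to [y], so by the closed graph a limit of the
   [s z] is in [Sel y], against the separation. *)
have [N0 far] : exists N0, forall n, (N0 <= n)%N -> forall z, closureS e z ->
    gdist g (h n) (x (h n)) z < / INR (h n).+1 -> f (s z) <= f y - d / 2.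
  apply: contrapT => nfar.
  have [l [ll lP]] : exists l, subseq_index l /\ forall n, exists z,
      [/\ closureS e z, gdist g (h (l n)) (x (h (l n))) z < / INR (h (l n)).+1 &
         f y - d / 2 < f (s z)].
    apply: (@subseq_exists (fun _ n => exists z, [/\ closureS e z,
      gdist g (h n) (x (h n)) z < / INR (h n).+1 & f y - d / 2 < f (s z)])) => _ N.
    apply: contrapT => nN; apply: nfar; exists N => n Nn z ez hz.
    by apply: Rnot_lt_le => fz; apply: nN; exists n; split=> //; exists z.
  have /choice[z zP] := lP.
  have ez n : closureS e (z n) by case: (zP n).
  have Dz n : D (z n) by apply: clD.
  have [|h1 [z' [hh1 zz']]] := weak_seq_compact Vrefl (u := z).
    by exists M => n; apply: DM.
  have [|h2 [u' [hh2 su']]] := weak_seq_compact Vrefl (u := fun n => s (z (h1 n))).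
    by exists M => n; apply: DM; case: (sP _ (Dz (h1 n))).
  have zy : z' = y.
    apply: gsep => // [|k]; first exact: (weak_cv_closed ecl ecv _ zz').
    apply: UL_sequence (zz' _ (gd k)) _ => t t0.
    pose r n := h (l (h1 n)).
    have rr : subseq_index r.
      by apply: (subseq_index_comp hh); apply: (subseq_index_comp ll).
    have [|N1 hN1] := @inv_INR_lt (t / 2); first lra.
    have [|N2 hN2] := Un_cv_subseq (subseq_index_comp ll hh1) (xy _ (gd k)) (eps := t / 2); first lra.
    exists (maxn k.+1 (maxn N1 N2)) => n /leP; rewrite !geq_max => /and3P[kn n1 /leP n2].
    have := hN2 n n2; rewrite /R_dist /= => e2.
    have rn := subseq_index_ge n rr.
    have [_ e1 _] := zP (h1 n); have e3 := hN1 (r n) (leq_trans n1 rn).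
    have := gdist_ge g (x (r n)) (z (h1 n)) (leq_trans kn rn); rewrite Rabs_minus_sym => e4.
    have := Rabs_triang (g k (z (h1 n)) - g k (x (r n))) (g k (x (r n)) - g k y).
    rewrite (_ : _ + _ = g k (z (h1 n)) - g k y); last ring.
    by rewrite /r in e2 e3 e4 *; lra.
  have Syu : Sel y u'.
    rewrite -zy; apply: (Sel_graph (w := fun n => z (h1 (h2 n))) (u := fun n => s (z (h1 (h2 n))))) => //.
    - by move=> n; case: (sP _ (Dz (h1 (h2 n)))).
    - by move=> n; case: (sP _ (Dz (h1 (h2 n)))).
    - exact: weak_cv_subseq zz'.
  have Du : D u'.
    by apply: (weak_cv_closed D_cl D_cv _ su') => n; case: (sP _ (Dz (h1 (h2 n)))).
  have := fS u' (conj Du Syu); have [|N hN] := su' f fd (d / 2); first lra.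
  have := hN N (le_n _); have [_ _] := zP (h1 (h2 N)).
  by rewrite /R_dist => h3 /Rabs_def2; lra.
have [|N hN] := xy f fd (d / 2); first lra.
pose n := maxn N N0; have [_ [K [l [[l0 l1] xE hl]]]] := xP (h n).
(* [x (h n)] is a convex combination of values [s (e i)] with near base points, so the bound is
   inherited; it contradicts weak convergence to [y]. *)
have : f (x (h n)) <= f y - d / 2.
  rewrite xE (dual_vcomb _ _ fd) -[f y - d / 2]Rmult_1_r -l1 -rsumZ.
  apply: rsum_le => i; rewrite (Rmult_comm (f y - d / 2)); have [li|li] := l0 i; last first.
    by rewrite -li; lra.
  apply: Rmult_le_compat_l; first lra.
  by apply: (far n (leq_maxr _ _) _ (closureS_seq e i)); apply: hl.
by have := hN n (leP (leq_maxl N N0)); rewrite /R_dist => /Rabs_def2; lra.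
Qed.

End Kluge.

(** * Continuity of lower semicontinuous convex functions *)

Definition ext_val (o : ERbar) : R := if o is Some p then p else 0.

Section ConvexContinuity.
Variables (V : Banach) (phi : V -> ERbar).
Hypotheses (phi_cvx : convex_fun phi) (phi_lsc : lsc_fun phi).

Lemma nested_balls (b : nat -> V * R) : (forall n, 0 < (b n).2) ->
  (forall n, (b n.+1).2 <= (b n).2 / 2) ->
  (forall n, ns_norm (ns_sub (b n.+1).1 (b n).1) + (b n.+1).2 <= (b n).2) ->
  exists l, forall n, ns_norm (ns_sub l (b n).1) <= (b n).2.
Proof.
move=> b0 bhalf bnest.
have in_ball n k : ns_norm (ns_sub (b (k + n)%N).1 (b n).1) + (b (k + n)%N).2 <= (b n).2.
  elim: k => [|k IH]; first by rewrite add0n ns_sub_self ns_norm0; lra.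
  have := bnest (k + n)%N; rewrite -addSn.
  by have := ns_dist_triangle (b (k + n)%N).1 (b (k.+1 + n)%N).1 (b n).1; lra.
have in_ball' n m : (n <= m)%N -> ns_norm (ns_sub (b m).1 (b n).1) <= (b n).2.
  by move=> nm; have := in_ball n (m - n)%N; rewrite subnK //; have := b0 m; lra.
have small n : (b n).2 <= (b 0%N).2 * (/ 2) ^ n.
  by elim: n => [|n IH]; [rewrite /=; lra | rewrite -tech_pow_Rmult; have := bhalf n; lra].
have [|l hl] := @bs_complete V (fun n => (b n).1).
  move=> e e0; have e1 : 0 < e / 2 / (b 0%N).2 by apply: Rdiv_lt_0_compat => //; lra.
  have [|N hN] := pow_lt_1_zero (/2) _ _ e1; first by rewrite Rabs_right; lra.
  have bN : (b N).2 < e / 2.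
    apply: Rle_lt_trans (small N) _; have := hN N (le_n _).
    rewrite Rabs_right; last by apply/Rle_ge/pow_le; lra.
    move=> /(Rmult_lt_compat_l _ _ _ (b0 0%N)).
    by rewrite (_ : (b 0%N).2 * (_ / _) = e / 2) //; field; have := b0 0%N; lra.
  exists N => n p /leP nN /leP pN.
  have := ns_dist_triangle (b N).1 (b n).1 (b p).1.
  by rewrite (ns_distC (b N).1); have := in_ball' N n nN; have := in_ball' N p pN; lra.
exists l => n; apply: le_eps => e e0; have [N hN] := hl e e0.
have := hN (maxn N n) (leP (leq_maxl _ _)); have := in_ball' _ _ (leq_maxr N n).
have := ns_dist_triangle (b (maxn N n)).1 l (b n).1.
by rewrite (ns_distC l (b (maxn N n)).1); lra.
Qed.

(** By lower semicontinuity each set where [phi] exceeds [n] is open. Were [phi] unbounded on every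
    ball inside the given one, nested balls would produce a point there with [phi] above every
    integer, though [phi] is finite. The conclusion [~ ext_gt] includes finiteness. *)
Lemma baire_bounded_ball x d : 0 < d ->
  (forall y, ns_norm (ns_sub y x) < d -> phi y <> None) ->
  exists w r M, [/\ 0 < r, ns_norm (ns_sub w x) < d &
    forall y, ns_norm (ns_sub y w) < r -> ~ ext_gt (phi y) M].
Proof.
move=> d0 hd; apply: contrapT => nh.
have /choice[st stP] : forall q : nat * (V * R), exists q' : V * R,
    ns_norm (ns_sub q.2.1 x) + q.2.2 < d -> 0 < q.2.2 ->
    [/\ 0 < q'.2, q'.2 <= q.2.2 / 2, ns_norm (ns_sub q'.1 q.2.1) + q'.2 <= q.2.2 &
       forall z, ns_norm (ns_sub z q'.1) <= q'.2 -> ext_gt (phi z) (INR q.1)].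
  move=> [n [w r]] /=; have [[wd r0]|nv] := pselect (ns_norm (ns_sub w x) + r < d /\ 0 < r); last first.
    by exists (w, r) => ? ?; case: nv.
  have [y [yw hy]] : exists y, ns_norm (ns_sub y w) < r /\ ext_gt (phi y) (INR n).
    apply: contrapT => ny; apply: nh; exists w, r, (INR n); split=> //; first lra.
    by move=> y yw hy; apply: ny; exists y.
  have [dl [dl0 hdl]] := phi_lsc hy.
  exists (y, Rmin (dl / 2) (Rmin (r / 2) (r - ns_norm (ns_sub y w)))) => _ _ /=.
  set m := Rmin _ _; have m1 : m <= dl / 2 by apply: Rmin_l.
  have m2 : m <= r / 2 by apply: Rle_trans (Rmin_r _ _) (Rmin_l _ _).
  have m3 : m <= r - ns_norm (ns_sub y w) by apply: Rle_trans (Rmin_r _ _) (Rmin_r _ _).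
  split; [by do 2?apply: Rmin_pos; lra | exact: m2 | lra |].
  by move=> z zy; apply: hdl; lra.
pose b := fix b n : V * R := if n is n'.+1 then st (n', b n') else (x, d / 2).
have bP n : ns_norm (ns_sub (b n).1 x) + (b n).2 < d /\ 0 < (b n).2.
  elim: n => [|n [h1 h2]] /=; first by rewrite ns_sub_self ns_norm0; lra.
  have [h3 h4 h5 _] := stP (n, b n) h1 h2; split=> //.
  have := ns_dist_triangle (b n).1 (st (n, b n)).1 x; move: h5 => /=; lra.
have bS n := stP (n, b n) (proj1 (bP n)) (proj2 (bP n)).
have [|||l hl] := @nested_balls b.
- by move=> n; case: (bP n).
- by move=> n; case: (bS n).
- by move=> n; case: (bS n).
have lx : ns_norm (ns_sub l x) < d.
  have := ns_dist_triangle (b 0%N).1 l x; have := hl 0%N; have [] := bP 0%N; lra.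
have lgt n : ext_gt (phi l) (INR n).
  by have [_ _ _ h] := bS n; apply: (h l); apply: (hl n.+1).
case E : (phi l) => [p|]; last exact: (hd l lx).
have [n hn] := INR_unbounded p.
by have := lgt n; rewrite E /=; lra.
Qed.

(** The bounded ball around [w] is carried to [x] by convexity: with [p = 2 x - w], a point [y] near
    [x] is the midpoint of [p] and of [q = w + 2 (y - x)], which is near [w]. *)
Lemma convex_locally_bounded x d : 0 < d ->
  (forall y, ns_norm (ns_sub y x) < d -> phi y <> None) ->
  exists r M, 0 < r /\ forall y, ns_norm (ns_sub y x) < r -> exists p, phi y = Some p /\ p <= M.
Proof.
move=> d0 hd; have [w [r [M [r0 wx hw]]]] := baire_bounded_ball d0 hd.
pose p := ns_sub (ns_add x x) w.
have px : phi p <> None.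
  by apply: hd; rewrite (_ : ns_sub p x = ns_sub x w); [rewrite ns_distC | rewrite /p; vec].
case E : (phi p) => [a|//]; exists (Rmin (r / 2) d), (/ 2 * M + (1 - / 2) * a).
split=> [|y yx]; first by apply: Rmin_pos; lra.
pose q := ns_add w (ns_scal 2 (ns_sub y x)).
have := hw q; case Eq : (phi q) => [c|] /=; last first.
  move=> h; exfalso; apply: (h _ I); rewrite (_ : ns_sub q w = ns_scal 2 (ns_sub y x)); last by rewrite /q; vec.
  by rewrite ns_scal_pos; [have := Rmin_l (r / 2) d; lra | lra].
move=> h; have cM : c <= M.
  apply: Rnot_lt_le; apply: h; rewrite (_ : ns_sub q w = ns_scal 2 (ns_sub y x)); last by rewrite /q; vec.
  by rewrite ns_scal_pos; [have := Rmin_l (r / 2) d; lra | lra].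
have [|b []] := phi_cvx Eq E (t := / 2); first lra.
rewrite (_ : ns_add _ _ = y); last by rewrite /q /p; vec.
by move=> -> hb; exists b; split=> //; lra.
Qed.

Lemma convex_continuous (u : nat -> V) x d : 0 < d ->
  (forall y, ns_norm (ns_sub y x) < d -> phi y <> None) ->
  ns_cv u x -> Un_cv (fun n => ext_val (phi (u n))) (ext_val (phi x)).
Proof.
move=> d0 hd ux e e0; have [r [M [r0 hr]]] := convex_locally_bounded d0 hd.
have [a [Ea aM]] : exists a, phi x = Some a /\ a <= M.
  by apply: hr; rewrite ns_sub_self ns_norm0.
have [|dl [dl0 hdl]] := @phi_lsc x (a - e); first by rewrite Ea /=; lra.
(* Lower semicontinuity gives the lower bound. For the upper one, [u n] is written as
   [s y + (1 - s) x] with [y] in the bounded ball, so [phi] rises by at most [s * (M - a)], and [s]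
   is chosen to keep this below [e]. *)
pose s := Rmin 1 (e / 2 / (M - a + 1)).
have s0 : 0 < s by apply: Rmin_pos; [lra | apply: Rdiv_lt_0_compat; lra].
have s1 : s <= 1 by apply: Rmin_l.
have sM : s * (M - a) < e.
  have : s * (M - a + 1) <= e / 2 / (M - a + 1) * (M - a + 1).
    by apply: Rmult_le_compat_r; [lra | apply: Rmin_r].
  rewrite (_ : _ / _ * _ = e / 2); last by field; lra.
  by nra.
have m0 : 0 < Rmin dl (s * r) by apply: Rmin_pos => //; apply: Rmult_lt_0_compat.
have [N hN] := ux _ m0; exists N => n /hN h.
have h1 : ns_norm (ns_sub (u n) x) < dl by have := Rmin_l dl (s * r); lra.
have h2 : ns_norm (ns_sub (u n) x) < s * r by have := Rmin_r dl (s * r); lra.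
pose y := ns_add x (ns_scal (/ s) (ns_sub (u n) x)).
have [c [Ec cM]] : exists c, phi y = Some c /\ c <= M.
  apply: hr; rewrite (_ : ns_sub y x = ns_scal (/ s) (ns_sub (u n) x)); last by rewrite /y; vec.
  rewrite ns_scal_pos; last by apply/Rlt_le/Rinv_0_lt_compat.
  apply: (Rmult_lt_reg_l s) => //; rewrite -Rmult_assoc Rinv_r; lra.
have [|b []] := phi_cvx Ec Ea (t := s); first lra.
rewrite (_ : ns_add _ _ = u n); last by rewrite /y; vec.
move=> Eb hb; have := hdl _ h1; rewrite /R_dist Eb Ea /= => hl.
by apply: Rabs_def1; nra.
Qed.

End ConvexContinuity.

(** * Existence of optimal parameters *)

Lemma ns_cv_bounded (X : NormedSpace) (y : nat -> X) l : ns_cv y l -> bounded_seq y.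
Proof.
move=> yl; have [|N hN] := yl 1; first lra.
have [M hM] : exists M, forall n, (n < N)%N -> ns_norm (y n) <= M.
  elim: N {hN} => [|N [M hM]]; first by exists 0.
  exists (Rmax M (ns_norm (y N))) => n; rewrite ltnS leq_eqVlt => /orP[/eqP->|/hM h].
    exact: Rmax_r.
  exact: Rle_trans h (Rmax_l _ _).
exists (Rmax M (1 + ns_norm l)) => n; have [/hM h|/leP/hN h] := ltnP n N.
  exact: Rle_trans h (Rmax_l _ _).
by apply: Rle_trans (Rmax_r _ _); have := ns_norm_le_dist (y n) l; lra.
Qed.

(** * Solutions under weak limits and perturbed parameters *)

Section Stability.
Variables (V B L : Banach).
Hypothesis Vrefl : reflexive V.
Variables (C : V -> Prop) (A : B -> Prop) (T : B -> V -> V -> R) (phi : V -> ERbar).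
Variables (K : V -> V -> Prop) (m : V -> R) (iBL : B -> L).
Hypotheses (C_ne : ne_set C) (C_cl : closedS C) (C_cv : convexS C) (m_dual : in_dual m).
Hypotheses (A_bd : boundedS A) (hT : H_T A T) (hK : H_K C K) (hphi : H_phi C phi).
Hypotheses (h0 : H_0 A T phi C K) (h2 : H_2 iBL A T).

Let psi x := ext_val (phi x).
Let F a u w := T a u w - m w.
Let Sel a w u := vi_sol (F a) psi (K w) u.

Lemma phi_finite x : C x -> phi x = Some (psi x).
Proof.
case: hphi => _ [_ [_ h]] Cx; have [d [d0 hd]] := h x Cx; rewrite /psi.
by case E: (phi x) => [p|] //; case: (hd x); rewrite ?ns_sub_self ?ns_norm0 // E.
Qed.

Lemma psi_convex : convex_on C psi.
Proof.
case: hphi => _ [h _] x y t Cx Cy t01.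
have [p [Ep hp]] := h _ _ _ _ t (phi_finite Cx) (phi_finite Cy) t01.
by rewrite {1}/psi Ep.
Qed.

Lemma psi_continuous : continuous_on C psi.
Proof.
case: hphi => _ [h1 [h2' h3]] u x Cu Cx ux; have [d [d0 hd]] := h3 x Cx.
exact: (convex_continuous h1 h2' d0 hd ux).
Qed.

Lemma K_sub w v : C w -> K w v -> C v.
Proof. by case: hK => h _ Cw; case: (h w Cw) => h' _; apply: h'. Qed.

Lemma K_closed w : C w -> closedS (K w).
Proof. by case: hK => h _ Cw; case: (h w Cw) => _ [_ []]. Qed.

Lemma K_convex w : C w -> convexS (K w).
Proof. by case: hK => h _ Cw; case: (h w Cw) => _ [_ []]. Qed.

Lemma psi_convex_K w : C w -> convex_on (K w) psi.
Proof. by move=> Cw x y t Kx Ky; apply: psi_convex; apply: K_sub Cw _. Qed.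

Lemma psi_continuous_K w : C w -> continuous_on (K w) psi.
Proof.
by move=> Cw u x Ku Kx; apply: psi_continuous => [n|]; apply: K_sub Cw _.
Qed.

Lemma GammaP a u : Gamma T phi C K m a u <-> C u /\ Sel a u u.
Proof.
split=> [[Cu [Ku [pu [Eu h]]]]|[Cu [Ku h]]].
  split=> //; split=> // v Kv; have := h v Kv.
  by rewrite (phi_finite (K_sub Cu Kv)) /F /psi Eu /=; lra.
split=> //; split=> //; exists (psi u); split; first exact: phi_finite.
by move=> v Kv; rewrite (phi_finite (K_sub Cu Kv)); have := h v Kv; rewrite /F; lra.
Qed.

Lemma F_dual a u : in_dual (F a u).
Proof.
case: hT => h _; have Td := h a u; split=> [x y|]; first by rewrite /F (dualD Td) (dualD m_dual); ring.
split=> [r x|]; first by rewrite /F (dualZ Td) (dualZ m_dual); ring.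
have [c [_ hc]] := dual_bound Td; have [c' [_ hc']] := dual_bound m_dual.
exists (c + c') => x; rewrite /F /Rminus; have := Rabs_triang (T a u x) (- m x); rewrite Rabs_Ropp.
by have := hc x; have := hc' x; lra.
Qed.

Lemma F_mono a : A a -> forall u v, F a u (ns_sub u v) - F a v (ns_sub u v) >= 0.
Proof. by case: hT => _ [_ [_ [_ [h _]]]] Aa u v; have := h a Aa u v; rewrite /F; lra. Qed.

Lemma F_cont a : A a -> forall u eps, eps > 0 -> exists delta, delta > 0 /\
  forall v, ns_norm (ns_sub v u) < delta -> functional_bounded_by (fun w => F a v w - F a u w) eps.
Proof.
case: hT => _ [_ [_ [_ [_ h]]]] Aa u eps e0; have [d [d0 hd]] := h a Aa u eps e0.
exists d; split=> // v vu x; rewrite /F (_ : _ - _ = T a v x - T a u x); last ring.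
exact: hd.
Qed.

Lemma psi_weak_lsc (u : nat -> V) x e : (forall n, C (u n)) -> weak_cv u x -> 0 < e ->
  exists N, forall n, (N <= n)%N -> psi x - e < psi (u n).
Proof.
move=> Cu ux e0; apply: contrapT => nh.
have [h [hh hu]] : exists h, subseq_index h /\ forall n, psi (u (h n)) <= psi x - e.
  apply: (@subseq_exists (fun _ n => psi (u n) <= psi x - e)) => _ N; apply: contrapT => nN.
  by apply: nh; exists N => n Nn; apply: Rnot_le_lt => hn; apply: nN; exists n.
(* With the zero operator the Minty sublevel sets become the sublevel sets of [psi] on [C]. *)
have Z0 : forall _ : V, in_dual (fun _ : V => 0).
  move=> _; split=> [*|]; first ring; split=> [*|]; first ring.
  by exists 0 => x0; rewrite Rabs_R0; lra.
have [Scl Scv] := @minty_sublevel_closed_convex V (fun _ _ => 0) psi Z0 C ns_zero (psi x - e)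
  C_cl C_cv psi_convex psi_continuous.
have [|_] := weak_cv_closed Scl Scv _ (weak_cv_subseq hh ux); last lra.
by move=> n; split=> //; have := hu n; lra.
Qed.

(** A test point [v] of [K w'] is approximated strongly by [y n] in [K (w n)]. Monotonicity moves
    the operator from [u n] to [y n], and linearity splits [a n] into [a n - a'], handled by [H_2],
    and [a'], handled by continuity at [v]. *)
Lemma Sel_limit (a : nat -> B) a' (w u : nat -> V) w' u' :
  (forall n, A (a n)) -> A a' -> ns_cv (fun n => iBL (a n)) (iBL a') ->
  (forall n, C (w n)) -> (forall n, C (u n)) -> bounded_seq u ->
  (forall n, Sel (a n) (w n) (u n)) -> weak_cv w w' -> weak_cv u u' -> Sel a' w' u'.
Proof.
move=> Aa Aa' aa Cw Cu [M uM] hu ww uu.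
have Cw' : C w' by apply: weak_cv_closed ww.
have Ku' : K w' u' by case: hK => _ [_ h]; apply: (h w u) => // n; case: (hu n).
apply/(vi_minty (F_dual a') (F_mono Aa') (F_cont Aa') _ (K_convex Cw') (psi_convex_K Cw')).
split=> // v Kv; have [y [Cy [Ky yv]]] : exists y : nat -> V,
    (forall n, C (y n)) /\ (forall n, K (w n) (y n)) /\ ns_cv y v.
  by case: hK => _ [h _]; apply: (h w w').
have [My yM] := ns_cv_bounded yv.
have [_ [_ [TD [_ [_ Tc]]]]] := hT.
pose z n := ns_sub (y n) (u n).
have zM n : ns_norm (z n) <= My + M.
  by apply: Rle_trans (ns_norm_sub _ _) _; have := yM n; have := uM n; lra.
have M0 : 0 <= My + M by have := zM 0%N; have := ns_norm_ge0 (z 0%N); lra.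
(* Five limits each cost [e]; continuity of [T a'] at [v] costs [e] times the norm of [z n]. *)
apply: (@le_eps_scal _ _ (5 + (My + M))) => [|e e0]; first lra.
have [N1 hN1] : exists N, forall n, (n >= N)%coq_nat -> T (ns_sub (a n) a') (y n) (z n) <= e.
  by apply: (h2 (vl := v)) => //; [case: A_bd => MA hA; exists MA => n; apply: hA | exists (My + M)].
have [dl [dl0 hdl]] := Tc a' Aa' v e e0.
have [N2 hN2] := yv dl dl0.
have [N3 hN3] := ns_cv_weak yv (F_dual a' v) e0.
have [N4 hN4] := uu _ (F_dual a' v) e e0.
have [N5 hN5] := psi_continuous Cy (K_sub Cw' Kv) yv e0.
have [N6 hN6] := psi_weak_lsc Cu uu e0.
pose n := (N1 + (N2 + (N3 + (N4 + (N5 + N6)))))%N.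
have := hN1 n ltac:(lia); have := hN3 n ltac:(lia); have := hN4 n ltac:(lia).
have := hN5 n ltac:(lia); have := hN6 n ltac:(lia); have := hdl _ (hN2 n ltac:(lia)) (z n).
have := hu n => -[_ /(_ (y n) (Ky n))]; have := F_mono (Aa n) (y n) (u n); rewrite -/(z n).
have TE : T (a n) (y n) (z n) = T (ns_sub (a n) a') (y n) (z n) + T a' (y n) (z n).
  by rewrite -TD; congr (T _ _ _); vec.
have ze : e * ns_norm (z n) <= e * (My + M) by apply: Rmult_le_compat_l (zM n); lra.
have zE : F a' v (z n) = F a' v (y n) - F a' v (u n) by rewrite /z (dualB (F_dual a' v)).
rewrite (dualB (F_dual a' v) v u') /R_dist => h1 h3 /Rabs_le_inv h4 h5 /Rabs_def2 h6.
move=> /Rabs_def2 h7 /Rabs_def2 h8 h9.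
by rewrite {1}/F TE in h1; rewrite {1}/F in zE; lra.
Qed.

Lemma coercive_bound : exists rho, forall a w, A a -> C w -> exists v0, K w v0 /\
  forall u, C u -> F a u (ns_sub u v0) + psi u - psi v0 <= 0 -> ns_norm u <= rho.
Proof.
have [C0 [h [[M0 C0M] [KC0 [hlim hco]]]]] := h0.
have [c [c0 mc]] := dual_bound m_dual; pose M1 := Rmax M0 0.
have M10 : 0 <= M1 by apply: Rmax_r.
(* For norms above 1 this level makes the coercive term exceed the bound [c * (ns_norm u + M1)] on
   [m (ns_sub u v0)]. *)
have [t0 ht0] := hlim (c * (1 + M1) + 1).
exists (Rmax t0 1) => a w Aa Cw; have [v0 [Kv0 Cv0]] := KC0 w Cw.
exists v0; split=> // u Cu hu; apply: Rnot_lt_le => ut.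
have u1 : 1 < ns_norm u by have := Rmax_r t0 1; lra.
have uh := ht0 (ns_norm u) ltac:(have := Rmax_l t0 1; lra).
have [pw [pv [Ew [Ev]]]] := hco v0 a u Cv0 Aa Cu.
have vM : ns_norm v0 <= M1 by apply: Rle_trans (C0M _ Cv0) (Rmax_l _ _).
have mu : m (ns_sub u v0) <= c * (ns_norm u + M1).
  apply: Rle_trans (dual_le _ mc) _; apply: Rmult_le_compat_l => //.
  by have := ns_norm_sub u v0; lra.
move: hu; rewrite /F /psi Ew Ev /= => hu hw.
have : (c * (1 + M1) + 1) * ns_norm u <= c * (ns_norm u + M1).
  by have : (c * (1 + M1) + 1) * ns_norm u <= h (ns_norm u) * ns_norm u; [nra | lra].
have := Rmult_le_pos _ _ c0 M10; nra.
Qed.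

Lemma Sel_bounded : exists rho, forall a w u, A a -> C w -> Sel a w u -> ns_norm u <= rho.
Proof.
have [rho h] := coercive_bound; exists rho => a w u Aa Cw [Ku hu].
have [v0 [Kv0 hv0]] := h a w Aa Cw; apply: hv0; first exact: K_sub Cw Ku.
have := hu v0 Kv0; rewrite (_ : ns_sub v0 u = ns_opp (ns_sub u v0)); last by vec.
by rewrite (dualN (F_dual a u)); lra.
Qed.

Lemma Gamma_nonempty a : A a -> exists u, Gamma T phi C K m a u.
Proof.
move=> Aa; have [rho hrho] := coercive_bound.
pose D x := C x /\ ns_norm x <= rho.
have Selne w : C w -> exists u, D u /\ Sel a w u.
  move=> Cw; have [v0 [Kv0 hv0]] := hrho a w Aa Cw.
  have [|u [Su ur]] := vi_coercive Vrefl (F_dual a) (F_mono Aa) (F_cont Aa) Kv0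
    (K_closed Cw) (K_convex Cw) (psi_convex_K Cw) (psi_continuous_K Cw) (rho := rho).
    by move=> u Ku; apply: hv0; apply: K_sub Cw Ku.
  by exists u; split=> //; split=> //; apply: K_sub Cw _; case: Su.
have Dcl : closedS D.
  move=> u x Du ux; split; first by apply: C_cl ux => n; case: (Du n).
  apply: le_eps => e e0; have [N hN] := ux e e0; have := hN N (le_n _).
  by have [_] := Du N; have := ns_norm_le_dist x (u N); rewrite ns_distC; lra.
have Dcv : convexS D.
  move=> x y t [Cx hx] [Cy hy] t01; split; first exact: C_cv.
  by apply: Rle_trans (ns_norm_triangle _ _ _) _; rewrite !ns_scal_pos; nra.
have [|||||w [[Cw _] Sw]] := @kluge V D (Sel a) Vrefl _ Dcl Dcv.
- by have [w Cw] := C_ne; have [u [Du _]] := Selne w Cw; exists u.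
- by exists rho => x [].
- by move=> w [Cw _]; apply: Selne.
(* Convexity is read off Minty's form, where each inequality is a convex condition on the
   solution. *)
- move=> w [Cw _] x y t [Dx Sx] [Dy Sy] t01; split; first exact: Dcv.
  have vm u := vi_minty (F_dual a) (F_mono Aa) (F_cont Aa) u (K_convex Cw) (psi_convex_K Cw).
  apply/vm; have /vm[Kx hx] := Sx; have /vm[Ky hy] := Sy.
  split=> [|v Kv]; first exact: K_convex.
  have [_ Scv] := minty_sublevel_closed_convex (F_dual a) v (F a v v + psi v)
    (K_closed Cw) (K_convex Cw) (psi_convex_K Cw) (psi_continuous_K Cw).
  have [] := Scv x y t _ _ t01.
  + by split=> //; have := hx v Kv; rewrite (dualB (F_dual a v)); lra.
  + by split=> //; have := hy v Kv; rewrite (dualB (F_dual a v)); lra.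
  + by rewrite [X in _ -> _ -> 0 <= X + _ - _](dualB (F_dual a v)); lra.
- move=> w u w' u' Dw Du Swu ww uu.
  apply: (Sel_limit (a := fun=> a) (w := w) (u := u)) => //.
  + by move=> e e0; exists 0%N => *; rewrite ns_sub_self ns_norm0.
  + by move=> n; case: (Dw n).
  + by move=> n; case: (Du n).
  + by exists rho => n; case: (Du n).
by exists w; apply/GammaP.
Qed.

Lemma Gamma_limit (a : nat -> B) a' (u : nat -> V) :
  (forall n, A (a n)) -> A a' -> ns_cv (fun n => iBL (a n)) (iBL a') ->
  (forall n, Gamma T phi C K m (a n) (u n)) ->
  exists h u', [/\ subseq_index h, weak_cv (fun n => u (h n)) u' & Gamma T phi C K m a' u'].
Proof.
move=> Aa Aa' aa hu; have [rho hrho] := Sel_bounded.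
have hu' n := proj1 (GammaP _ _) (hu n).
have ub n : ns_norm (u n) <= rho by have [Cu Su] := hu' n; apply: hrho (Aa n) Cu Su.
have [|h [u' [hh uu]]] := weak_seq_compact Vrefl (u := u); first by exists rho.
have Cuh n : C (u (h n)) by case: (hu' (h n)).
exists h, u'; split=> //; apply/GammaP; split; first exact: weak_cv_closed uu.
apply: (Sel_limit (a := fun n => a (h n)) (w := fun n => u (h n)) (u := fun n => u (h n))) => //.
- exact: (ns_cv_subseq hh aa).
- by exists rho.
- by move=> n; case: (hu' (h n)).
Qed.

End Stability.

(** The preimage in [V] of a closed ball of [Z] is closed and convex, hence weakly sequentially
    closed. *)
Lemma weak_limit_norm_le (V : NormedSpace) (Z : NormedSpace) (i : V -> Z) z (u : nat -> V) u' r :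
  bounded_linear i -> weak_cv u u' -> (exists N, forall n, (N <= n)%N -> ns_norm (ns_sub (i (u n)) z) <= r) ->
  ns_norm (ns_sub (i u') z) <= r.
Proof.
move=> [[iD iZ] [M iM]] uu [N hN].
have M0 x : ns_norm (i x) <= Rmax M 0 * ns_norm x.
  by apply: Rle_trans (iM x) _; apply: Rmult_le_compat_r; [exact: ns_norm_ge0 | exact: Rmax_l].
have Mp := Rmax_r M 0; set M' := Rmax M 0 in M0 Mp.
have iN x : i (ns_opp x) = ns_opp (i x) by rewrite !ns_oppE iZ.
pose S x := ns_norm (ns_sub (i x) z) <= r.
apply: (@weak_cv_closed V S (fun n => u (N + n)%N)).
- move=> v x Sv vx; apply: (@le_eps_scal _ _ M') => // e e0.
  have [k hk] := vx e e0; have := hk k (le_n _); have := Sv k; rewrite /S => h1 h2.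
  have := ns_dist_triangle (i (v k)) (i x) z.
  rewrite (_ : ns_sub (i x) (i (v k)) = i (ns_sub x (v k))); last by rewrite /ns_sub iD iN.
  have := M0 (ns_sub x (v k)); rewrite ns_distC in h2; nra.
- move=> x y t Sx Sy t01; rewrite /S iD !iZ.
  rewrite (_ : ns_sub _ z = ns_add (ns_scal t (ns_sub (i x) z)) (ns_scal (1 - t) (ns_sub (i y) z))); last by vec.
  apply: Rle_trans (ns_norm_triangle _ _ _) _; rewrite !ns_scal_pos; try lra.
  by move: Sx Sy; rewrite /S; nra.
- by move=> n; apply: hN; apply: leq_addr.
- by apply: (weak_cv_subseq (h := fun n => (N + n)%N)) => // n; rewrite ltn_add2l.
Qed.

Theorem theorem2p5
  (V B L E : Banach) (Z : Hilbert)
  (hVrefl : reflexive V)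
  (C : V -> Prop) (hCne : ne_set C) (hCcl : closedS C) (hCcv : convexS C)
  (A : B -> Prop) (hAne : ne_set A)
  (T : B -> V -> V -> R) (phi : V -> ERbar) (K : V -> V -> Prop)
  (m : V -> R) (hm : in_dual m)
  (iBL : B -> L) (iEL : E -> L) (jAE : B -> E) (Rf : E -> R)
  (hT : H_T A T) (hK : H_K C K) (hphi : H_phi C phi) (h0 : H_0 A T phi C K)
  (h1 : H_1 iBL iEL jAE A) (h2 : H_2 iBL A T) (h3 : H_3 iEL jAE A Rf)
  (iVZ : V -> Z) (hVZ : cont_embedding iVZ) (z : Z) :
  (forall kappa, kappa > 0 -> forall a, A a ->
     exists val, is_J T phi C K m iVZ z jAE Rf kappa a val) /\
  (forall kappa, kappa > 0 ->
     exists astar vstar, A astar /\ is_J T phi C K m iVZ z jAE Rf kappa astar vstar /\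
       forall b vb, A b -> is_J T phi C K m iVZ z jAE Rf kappa b vb -> vstar <= vb).
Proof.
have [_ [[_ Ecomp] [EA [_ [A_bd A_clL]]]]] := h1.
have [_ [Rlsc [tau1 [tau2 [t10 [_ hR]]]]]] := h3.
have [iVZ_lin _] := hVZ.
have Glim := Gamma_limit hVrefl hCcl hCcv hm A_bd hT hK hphi h0 h2.
have part1 kappa : kappa > 0 -> forall a, A a ->
    exists val, is_J T phi C K m iVZ z jAE Rf kappa a val.
  (* For fixed [a] the term in [R] is constant and squaring is increasing, so it suffices to
     minimize the distance to [z]. *)
  move=> k0 a Aa; pose Q r := exists u, Gamma T phi C K m a u /\ r = ns_norm (ns_sub (iVZ u) z).
  have [||d [dQ dlt]] := @inf_exists Q 0.
  - have [u hu] := Gamma_nonempty hVrefl hCne hCcl hCcv hm A_bd hT hK hphi h0 h2 Aa.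
    by exists (ns_norm (ns_sub (iVZ u) z)), u.
  - by move=> _ [u [_ ->]]; apply: ns_norm_ge0.
  have /choice[u uP] : forall n, exists u, Gamma T phi C K m a u /\
      ns_norm (ns_sub (iVZ u) z) < d + / INR n.+1.
    by move=> n; have [_ [[u [hu ->]] ud]] := dlt _ (inv_INR_gt0 n); exists u.
  have acv : ns_cv (fun=> iBL a) (iBL a).
    by move=> e e0; exists 0%N => *; rewrite ns_sub_self ns_norm0.
  have [h [u' [hh uu Gu]]] := Glim (fun=> a) a u (fun=> Aa) Aa acv (fun n => proj1 (uP n)).
  have ud : ns_norm (ns_sub (iVZ u') z) <= d.
    apply: le_eps => e e0; apply: (weak_limit_norm_le iVZ_lin uu).
    have [N hN] := inv_INR_lt e0; exists N => n Nn; have [_] := uP (h n).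
    by have := hN (h n) (leq_trans Nn (subseq_index_ge n hh)); lra.
  exists (cost iVZ z jAE Rf kappa a u'); split; first by exists u'.
  move=> v hv; rewrite /cost; apply: Rplus_le_compat_r; apply: Rmult_le_compat_l; first lra.
  by apply: pow_incr; split; [exact: ns_norm_ge0 | apply: Rle_trans ud _; apply: dQ; exists v].
split=> // kappa k0.
pose Q v := exists b, A b /\ is_J T phi C K m iVZ z jAE Rf kappa b v.
have Rbd b : A b -> - tau2 <= Rf (jAE b).
  by move=> Ab; have := hR b Ab; have := ns_norm_ge0 (jAE b); nra.
have [||d [dQ dlt]] := @inf_exists Q (- (kappa * tau2)).
- by have [a Aa] := hAne; have [v hv] := part1 kappa k0 a Aa; exists v, a.
- move=> v [b [Ab [[u [_ <-]] _]]]; rewrite /cost; have := Rbd b Ab.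
  by have := pow2_ge_0 (ns_norm (ns_sub (iVZ u) z)); nra.
have /choice[q qP] : forall n, exists q : B * V, [/\ A q.1, Gamma T phi C K m q.1 q.2 &
    cost iVZ z jAE Rf kappa q.1 q.2 < d + / INR n.+1].
  move=> n; have [v [[b [Ab [[u [hu e]] _]]] vd]] := dlt _ (inv_INR_gt0 n).
  by exists (b, u); split=> //=; rewrite e.
(* Near-optimal cost bounds [Rf], and its coercivity bounds the parameters in [E]. The compact
   embedding then gives convergence in [L], with limit in [A] by closedness there. *)
have [|h [l [hh jl]]] := Ecomp (fun n => jAE (q n).1).
  exists ((d + 1 + kappa * tau2) / (kappa * tau1)) => n; have [Ab _] := qP n.
  have i1 : / INR n.+1 <= 1.
    rewrite -[X in _ <= X]Rinv_1; apply: Rinv_le_contravar; first lra.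
    by rewrite S_INR; have := pos_INR n; lra.
  have kt : 0 < kappa * tau1 by apply: Rmult_lt_0_compat; lra.
  rewrite /cost; have := pow2_ge_0 (ns_norm (ns_sub (iVZ (q n).2) z)) => h4 h5.
  have h6 := Rmult_ge_compat_l kappa _ _ (Rgt_ge _ _ k0) (hR _ Ab).
  apply: (Rmult_le_reg_r (kappa * tau1)) => //.
  by rewrite (_ : _ / _ * _ = d + 1 + kappa * tau2); [lra | field; split; lra].
have Aq n : A (q n).1 by case: (qP n).
have hhn : subseq_index h by move=> n; apply/ltP; apply: hh.
have qL : ns_cv (fun n => iBL (q (h n)).1) l.
  by move=> e e0; have [N hN] := jl e e0; exists N => n /hN; rewrite EA.
have [a [Aa al]] := A_clL (fun n => (q (h n)).1) l (fun n => Aq (h n)) qL.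
rewrite -al in qL.
have Gq n : Gamma T phi C K m (q n).1 (q n).2 by case: (qP n).
have [h' [u [hh' uu Gu]]] := Glim (fun n => (q (h n)).1) a (fun n => (q (h n)).2)
  (fun n => Aq (h n)) Aa qL (fun n => Gq (h n)).
have ad : cost iVZ z jAE Rf kappa a u <= d.
  (* The minimizing sequence loses [e], and lower semicontinuity of [Rf] loses [kappa * e]. *)
  apply: (@le_eps_scal _ _ (1 + kappa)) => [|e e0]; first lra.
  have [|dl [dl0 hdl]] := Rlsc (jAE a) (Rf (jAE a) - e); first lra.
  have [N1 hN1] := ns_cv_subseq hh' qL dl0; have [N2 hN2] := inv_INR_lt e0.
  (* Solving [cost < d + e] for the squared norm, with [Rf] bounded below by [Rf (jAE a) - e], gives
     this bound on the tail. *)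
  pose s := 2 * (d + e - kappa * (Rf (jAE a) - e)).
  have hs n : (maxn N1 N2 <= n)%N -> ns_norm (ns_sub (iVZ (q (h (h' n))).2) z) ^ 2 <= s.
    rewrite geq_max => /andP[/leP/hN1 n1 n2]; have [Ab _] := qP (h (h' n)).
    rewrite /cost; have := hdl (jAE (q (h (h' n))).1); rewrite !EA // => /(_ n1) r1.
    have := hN2 (h (h' n)) _; move=> h5 h6.
    have {}h5 : / INR (h (h' n)).+1 < e.
      apply: h5; apply: leq_trans n2 _; apply: leq_trans (subseq_index_ge n hh') _.
      exact: subseq_index_ge.
    by rewrite /s; nra.
  have s0 : 0 <= s by apply: Rle_trans (hs _ (leqnn _)); apply: pow2_ge_0.
  have us : ns_norm (ns_sub (iVZ u) z) <= sqrt s.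
    apply: (weak_limit_norm_le iVZ_lin uu); exists (maxn N1 N2) => n /hs hn.
    rewrite -(sqrt_pow2 (ns_norm _)); last exact: ns_norm_ge0.
    exact: sqrt_le_1_alt.
  have : ns_norm (ns_sub (iVZ u) z) ^ 2 <= s.
    by rewrite -(pow2_sqrt s) //; apply: pow_incr; split=> //; apply: ns_norm_ge0.
  by rewrite /cost /s; lra.
have [v hv] := part1 kappa k0 a Aa; exists a, v; split=> //; split=> // b vb Ab hb.
apply: Rle_trans (dQ vb _); last by exists b.
by apply: Rle_trans ad; case: hv => _; apply.
Qed.
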